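(* Let $n\ge1$, $a>0$, $s>0$, and let $E\subset\mathbb{R}$ be a bounded set such that $$\sum_{m=0}^\infty N_E(2^{-m})\,2^{-2ms/a}<\infty.$$ Then there is a constant $C$ such that for every $f\in\mathscr{S}(\mathbb{R}^n)$, $$\left(\int_{\mathbb{R}^n}|S^*f(x)|^2\,dx\right)^{1/2}\le C\|f\|_{H_s},$$ where $S^*f(x)=\sup_{t\in E}|S_tf(x)|$ for $x\in\mathbb{R}^n$.
   Context: $\mathscr{S}(\mathbb{R}^n)$ is the Schwartz class. The Fourier transform is $\hat f(\xi)=\int_{\mathbb{R}^n}e^{-i\xi\cdot x}f(x)\,dx$. For $t\in\mathbb{R}$, $S_tf(x)=(2\pi)^{-n}\int_{\mathbb{R}^n}e^{i\xi\cdot x}e^{it|\xi|^a}\hat f(\xi)\,d\xi$. The Sobolev norm is $\|f\|_{H_s}=\left(\int_{\mathbb{R}^n}(1+|\xi|^2)^s|\hat f(\xi)|^2\,d\xi\right)^{1/2}$. For a bounded set $E\subset\mathbb{R}$ and $r>0$, $N_E(r)$ denotes the minimal number $N$ of intervals $I_1,\dots,I_N$ of length $r$ such that $E\subset\bigcup_{l=1}^N I_l$. *)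

(* Defs.v *)
From HB Require Import structures.
From mathcomp Require Import all_boot all_order all_algebra.
From mathcomp Require Import complex.
From mathcomp Require Import all_classical all_reals all_analysis.

Set Implicit Arguments.
Unset Strict Implicit.
Unset Printing Implicit Defensive.
Import Order.TTheory GRing.Theory Num.Theory.
Import numFieldNormedType.Exports.

Local Open Scope classical_set_scope.
Local Open Scope ring_scope.

Section measurable_rV.
Variables (R : realType) (n : nat).

(* The Borel sigma-algebra of R^n, generated by the coordinate functions. *)
Definition rV_coord (i : 'I_n) (x : 'rV[R]_n) : measurableTypeR R := x 0 i.

Let rV_set0 : g_sigma_preimage rV_coord set0.
Proof. exact: sigma_algebra0. Qed.

Let rV_setC A : g_sigma_preimage rV_coord A -> g_sigma_preimage rV_coord (~` A).
Proof. exact: sigma_algebraC. Qed.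

Let rV_bigcup (F : (set 'rV[R]_n)^nat) :
  (forall i, g_sigma_preimage rV_coord (F i)) ->
  g_sigma_preimage rV_coord (\bigcup_i (F i)).
Proof. exact: sigma_algebra_bigcup. Qed.

HB.instance Definition _ :=
  @isMeasurable.Build (measure_tuple_display R.-ocitv.-measurable.-sigma)
    'rV[R]_n (g_sigma_preimage rV_coord) rV_set0 rV_setC rV_bigcup.

End measurable_rV.

Definition rV_cons (R : realType) (n : nat)
    (p : measurableTypeR R * 'rV[R]_n) : 'rV[R]_n.+1 :=
  row_mx (p.1 : R)%:M p.2.

(* n-dimensional Lebesgue measure, by induction on n: R^0 is a point of mass 1
   and R^(n+1) is identified with R x R^n. *)
Fixpoint lebesgue_rV (R : realType) (n : nat) : set 'rV[R]_n -> \bar R :=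
  match n with
  | 0 => dirac (0 : 'rV[R]_0)
  | m.+1 => pushforward (lebesgue_measure \x @lebesgue_rV R m)%E (@rV_cons R m)
  end.
Arguments lebesgue_rV {R n}.

Section lebesgue_rV_measure.
Variable R : realType.

Lemma measurable_rV_coord n (i : 'I_n) :
  measurable_fun [set: 'rV[R]_n] (@rV_coord R n i).
Proof.
move=> _ Y mY; rewrite setTI; apply: sub_sigma_algebra => /=.
rewrite -bigcup_seq/=; exists i => /=; first by rewrite mem_index_enum.
by exists Y => //; rewrite setTI.
Qed.

Lemma measurable_to_rV d (T : measurableType d) n (f : T -> 'rV[R]_n) :
  (forall i, measurable_fun [set: T] (@rV_coord R n i \o f)) ->
  measurable_fun [set: T] f.
Proof.
move=> mf; apply: (@measurability _ _ _ _ _ _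
  (\big[setU/set0]_(i < n) preimage_set_system setT (@rV_coord R n i) measurable)).
- by [].
- move=> _ [B + <-]; rewrite -bigcup_seq => -[i /= _ [A mA <-]].
  rewrite setTI.
  by have := mf i measurableT A mA; rewrite !setTI.
Qed.

Lemma rV_cons0 n (p : measurableTypeR R * 'rV[R]_n) :
  rV_cons p 0 ord0 = p.1.
Proof.
transitivity (row_mx (p.1 : R)%:M p.2 0 (lshift n (ord0 : 'I_1))).
  by congr fun_of_matrix; exact/val_inj.
by rewrite row_mxEl mxE eqxx mulr1n.
Qed.

Lemma rV_consS n (p : measurableTypeR R * 'rV[R]_n) i :
  rV_cons p 0 (lift ord0 i) = p.2 0 i.
Proof.
transitivity (row_mx (p.1 : R)%:M p.2 0 (rshift 1 i)).
  by congr fun_of_matrix; exact/val_inj.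
by rewrite row_mxEr.
Qed.

Lemma measurable_rV_cons n :
  measurable_fun setT (@rV_cons R n).
Proof.
apply: measurable_to_rV => i.
case: (unliftP ord0 i) => [j ->|->].
- rewrite (_ : _ \o _ = @rV_coord R n j \o snd).
    apply: measurableT_comp => //; exact: measurable_rV_coord.
  by apply/funext => p; rewrite /= /rV_coord rV_consS.
- rewrite (_ : _ \o _ = fst) //.
  by apply/funext => p; rewrite /= /rV_coord rV_cons0.
Qed.

Definition rV_uncons n (x : 'rV[R]_n.+1) : measurableTypeR R * 'rV[R]_n :=
  (x 0 ord0, \row_i x 0 (lift ord0 i)).

Lemma rV_consK n : cancel (@rV_cons R n) (@rV_uncons n).
Proof.
move=> [a v]; rewrite /rV_uncons rV_cons0; congr pair.
by apply/rowP => i; rewrite mxE rV_consS.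
Qed.

Lemma measurable_rV_uncons n : measurable_fun setT (@rV_uncons n).
Proof.
apply: measurable_fun_pair; first exact: (@measurable_rV_coord n.+1 ord0).
apply: measurable_to_rV => i.
rewrite (_ : _ \o _ = @rV_coord R n.+1 (lift ord0 i)).
  exact: measurable_rV_coord.
by apply/funext => x; rewrite /= /rV_coord mxE.
Qed.

Section step.
Variables (n : nat) (mu : {sigma_finite_measure set 'rV[R]_n -> \bar R}).
Definition lebesgue_rV_succ :=
  pushforward (lebesgue_measure \x mu)%E (@rV_cons R n).
Local Notation nu := lebesgue_rV_succ.

Let nu0 : nu set0 = 0%E.
Proof. by rewrite /lebesgue_rV_succ /pushforward preimage_set0 measure0. Qed.

Let nu_ge0 A : (0 <= nu A)%E.
Proof. exact: (measure_ge0 (lebesgue_measure \x mu)%E). Qed.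

Let nu_sigma_additive : semi_sigma_additive nu.
Proof.
have mpre A : measurable A -> measurable (@rV_cons R n @^-1` A).
  by move=> mA; rewrite -[X in measurable X]setTI; exact: measurable_rV_cons.
move=> F mF tF mUF; rewrite /lebesgue_rV_succ /pushforward preimage_bigcup.
apply: measure_semi_sigma_additive.
- by move=> k; exact: mpre.
- apply/trivIsetP => /= i j _ _ ij; rewrite -preimage_setI.
  by move/trivIsetP : tF => /(_ _ _ _ _ ij) ->//; rewrite preimage_set0.
- by rewrite -preimage_bigcup; exact: mpre.
Qed.
HB.instance Definition _ := isMeasure.Build _ _ _ nu
  nu0 nu_ge0 nu_sigma_additive.

Let nu_sigma_finite : sigma_finite setT nu.
Proof.
have /sigma_finiteP[F [TF ndF Foo]] := sigma_finiteT (@lebesgue_measure R).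
have /sigma_finiteP[G [TG ndG Goo]] := sigma_finiteT mu.
exists (fun k => @rV_uncons n @^-1` (F k `*` G k)).
  rewrite -preimage_bigcup (_ : \bigcup_k _ = setT) ?preimage_setT//.
  rewrite -setXTT TF TG predeqE => -[x y]; split.
    by move=> [n' _ []/= ? ?]; split; exists n'.
  move=> [/= [i _ Fix] [j _ Gjy]]; exists (maxn i j) => //; split.
  - by move: x Fix; exact/subsetPset/ndF/leq_maxl.
  - by move: y Gjy; exact/subsetPset/ndG/leq_maxr.
move=> k; have [mF Fk] := Foo k; have [mG Gk] := Goo k; split.
  rewrite -[X in measurable X]setTI; apply: measurable_rV_uncons => //.
  exact: measurableX.
rewrite /lebesgue_rV_succ /pushforward -comp_preimage.
rewrite (_ : _ \o _ = id); last by apply/funext => p; exact: rV_consK.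
rewrite preimage_id product_measure1E// lte_mul_pinfty// ge0_fin_numE//.
Qed.

HB.instance Definition _ := Measure_isSigmaFinite.Build _ _ _ nu
  nu_sigma_finite.

Lemma lebesgue_rV_step :
  exists m : {sigma_finite_measure set 'rV[R]_n.+1 -> \bar R}, nu = m.
Proof. by exists nu. Qed.

End step.

Lemma lebesgue_rV_sigma_finite_measure n :
  exists mu : {sigma_finite_measure set 'rV[R]_n -> \bar R},
    lebesgue_rV = mu :> (set 'rV[R]_n -> \bar R).
Proof.
elim: n => [|n [mu muE]]; first by exists (dirac (0 : 'rV[R]_0)).
by rewrite /= muE; exact: lebesgue_rV_step.
Qed.

Variable n : nat.
Let leb := @lebesgue_rV R n.

Let leb0 : leb set0 = 0%E.
Proof.
by rewrite /leb; have [mu ->] := lebesgue_rV_sigma_finite_measure n.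
Qed.

Let leb_ge0 A : (0 <= leb A)%E.
Proof.
by rewrite /leb; have [mu ->] := lebesgue_rV_sigma_finite_measure n.
Qed.

Let leb_sigma_additive : semi_sigma_additive leb.
Proof.
rewrite /leb; have [mu ->] := lebesgue_rV_sigma_finite_measure n.
exact: measure_semi_sigma_additive.
Qed.

HB.instance Definition _ := isMeasure.Build _ _ _ (@lebesgue_rV R n)
  leb0 leb_ge0 leb_sigma_additive.

Let leb_sigma_finite : sigma_finite setT leb.
Proof.
rewrite /leb; have [mu ->] := lebesgue_rV_sigma_finite_measure n.
exact: sigma_finiteT.
Qed.

HB.instance Definition _ := Measure_isSigmaFinite.Build _ _ _
  (@lebesgue_rV R n) leb_sigma_finite.

End lebesgue_rV_measure.

Lemma lebesgue_rV_box (R : realType) (n : nat)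
    (A : 'I_n -> set (measurableTypeR R)) :
  (forall i, measurable (A i)) ->
  lebesgue_rV [set x : 'rV[R]_n | forall i, A i (x 0 i)] =
  (\prod_(i < n) lebesgue_measure (A i))%E.
Proof.
elim: n A => [|n IHn] A mA.
  rewrite big_ord0 /= (_ : [set _ | _] = setT); first by rewrite diracT.
  by apply/seteqP; split => // x _ [].
rewrite big_ord_recl -IHn//=.
have [mu muE] := lebesgue_rV_sigma_finite_measure R n.
rewrite muE -product_measure1E//.
- rewrite /pushforward; congr product_measure1.
  apply/seteqP; split => -[a v] /=.
    move=> h; split => [|i]; first by have := h ord0; rewrite rV_cons0.
    by have := h (lift ord0 i); rewrite rV_consS.
  move=> [h0 hS] i; case: (unliftP ord0 i) => [j ->|->].
    by rewrite rV_consS; exact: hS.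
  by rewrite rV_cons0.
- rewrite (_ : [set _ | _] =
    \bigcap_(i in [set: 'I_n]) (@rV_coord R n i @^-1` A (lift ord0 i))).
    apply: fin_bigcap_measurable => // i _.
    by rewrite -[X in measurable X]setTI; exact: measurable_rV_coord.
  by apply/seteqP; split => [x h i _|x h i]; [exact: h|exact: (h i Logic.I)].
Qed.

Section euclidean.
Variables (R : realType) (n : nat).
Implicit Types x y : 'rV[R]_n.

Definition dotp x y : R := \sum_(i < n) x 0 i * y 0 i.

(* The norm `|x| that the library puts on 'rV[R]_n is the sup norm. *)
Definition enorm x : R := Num.sqrt (dotp x x).

End euclidean.

Section schwartz.
Variables (R : realType) (n : nat).
Implicit Types (g : 'rV[R]_n -> R) (f : 'rV[R]_n -> R[i]).

(* A list of indices stands for an arbitrary iterated partial derivative. *)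
Fixpoint partials (s : seq 'I_n) g : 'rV[R]_n -> R :=
  if s is i :: s' then fun x => 'D_(delta_mx 0 i) (partials s' g) x else g.

Definition smooth g : Prop := forall s : seq 'I_n,
  continuous (partials s g) /\
  forall x (i : 'I_n), derivable (partials s g) x (delta_mx 0 i).

Definition rapidly_decreasing g : Prop :=
  forall (k : 'I_n -> nat) (s : seq 'I_n), exists M : R,
  forall x : 'rV[R]_n,
      `| (\prod_(i < n) x 0 i ^+ k i) * partials s g x | <= M.

(* Derivatives of a complex-valued function of real variables are taken on
   the real and imaginary parts. *)
Definition schwartz f : Prop :=
  (smooth (fun x => complex.Re (f x)) /\ rapidly_decreasing (fun x => complex.Re (f x))) /\
  (smooth (fun x => complex.Im (f x)) /\ rapidly_decreasing (fun x => complex.Im (f x))).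

End schwartz.

Section fourier.
Variables (R : realType) (n : nat).
Implicit Types f : 'rV[R]_n -> R[i].

Definition cintegral f : R[i] :=
  ((\int[lebesgue_rV]_x complex.Re (f x)) +i* (\int[lebesgue_rV]_x complex.Im (f x)))%C.

(* e^(i theta) *)
Definition expi (theta : R) : R[i] := (cos theta +i* sin theta)%C.

Definition modc (z : R[i]) : R := ComplexField.Normc.normc z.

Definition fourier f (xi : 'rV[R]_n) : R[i] :=
  cintegral (fun x => expi (- dotp xi x) * f x).

Definition propagator (a t : R) f (x : 'rV[R]_n) : R[i] :=
  (((2 * pi) ^- n)%:C)%C *
  cintegral (fun xi =>
    expi (dotp xi x) * expi (t * (enorm xi) `^ a) * fourier f xi).

(* 0 is adjoined to the set of moduli so that the supremum over an empty set
   of times is 0 rather than -oo. *)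
Definition maximal (a : R) (E : set R) f (x : 'rV[R]_n) : \bar R :=
  ereal_sup (0%E |` [set (modc (propagator a t f x))%:E | t in E]).

Definition sobolev_norm (s : R) f : \bar R :=
  ((\int[lebesgue_rV]_xi
      ((1 + enorm xi ^+ 2) `^ s * modc (fourier f xi) ^+ 2)%:E) `^ 2^-1)%E.

End fourier.

Section covering.
Variable R : realType.

Definition interval_cover (E : set R) (r : R) (N : nat) : Prop :=
  exists I : 'I_N -> set R,
    (forall l, is_interval (I l) /\ lebesgue_measure (I l) = r%:E) /\
    E `<=` \bigcup_l I l.

(* Extended-real valued: +oo when no finite cover exists. *)
Definition covering_number (E : set R) (r : R) : \bar R :=
  ereal_inf [set (N%:R)%:E | N in interval_cover E r].

End covering.

(* Main.v *)
From HB Require Import structures.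
Require Import Defs.
From mathcomp Require Import all_boot all_order all_algebra.
From mathcomp Require Import complex.
From mathcomp Require Import all_classical all_reals all_analysis.
From mathcomp Require Import measurable_realfun.
From mathcomp Require Import ring lra.
Import Order.TTheory GRing.Theory Num.Theory.
Import numFieldNormedType.Exports.
Local Open Scope classical_set_scope.
Local Open Scope ring_scope.

Set Implicit Arguments.
Unset Strict Implicit.
Unset Printing Implicit Defensive.

(** The proof is a chaining argument in the time variable. Put w(xi) = |xi|^a and b = 2^(2 sigma)
    with 0 < sigma < 1 and sigma a <= s. For every m take a finite net e_m at scale 2^-m and keep
    only the frequencies with w <= 2^m. If net points tau_m approach t at rate 2^-m, the truncated
    evolutions at tau_m converge to the full evolution at t. Each truncated evolution telescopes,
    along a chain of ancestors in coarser nets, into pieces. Since a time step of order 2^-m moves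
    the phase t w by at most a multiple of w/2^m, the multiplier of a piece of level m has square at
    most 4 (w/2^m)^2 on w <= 2^m ([amplitude_le]), and a Plancherel inequality turns this into an
    L^2 bound ([integral_piece_le]).

    At each level the maximum over the net is replaced by an l^2 sum, at the cost of a factor
    size(e_m). Cauchy-Schwarz with the weights size(e_m) b^-m, whose sum is finite, gives a majorant
    of the squared evolution that does not depend on t ([evolution_majorant]). In its integral the
    sizes cancel and the multiplier sum_m b^m gain_m remains ([integral_majorant]). As sigma < 1,
    this is a geometric sum bounded by a multiple of 1 + w^(2 sigma), hence of (1+|xi|^2)^s
    ([gain_sum_le]).

    If s < a, take sigma = s/a and nets inside E of size at most N_E(2^-m): the assumption on E is
    exactly the summability of the weights. If s >= a, take sigma = 3/4 and dyadic grids on an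
    interval containing E, of size O(2^m). Both cases are instances of [maximal_bound].

    Two analytic facts are proved on the way. [plancherel_le] bounds the L^2 norm of the transform
    of an integrable function: insert a compactly supported weight whose transform is dominated by
    Cauchy kernels, apply Schur's test, and remove the weight by Fatou. [osc_decay] shows by
    integration by parts that transforms of Schwartz functions are integrable, so that all of this
    applies to the real and imaginary parts of the Fourier transform of f. *)

(** * Borel measurability on R^n *)

Section rV_measurability.
Variables (R : realType) (n : nat).

Let mx_ballE (x y : 'rV[R]_n) (e : R) : ball x e y <->
  0 < e /\ forall i, `|x 0 i - y 0 i| < e.
Proof.
split=> [[e0 xy]|[e0 xy]]; split => //.
  by move=> i; exact: (xy 0 i).
by move=> i j; rewrite ord1; exact: xy.
Qed.

Lemma measurable_rV_ball (x : 'rV[R]_n) (e : R) : measurable (ball x e).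
Proof.
have [e0|e0] := ltP 0 e; last first.
  rewrite (_ : ball x e = set0) //; apply/seteqP; split => // y /mx_ballE[].
  by rewrite ltNge e0.
rewrite (_ : ball x e = \bigcap_(i in [set: 'I_n])
    (@rV_coord R n i @^-1` ball (x 0 i) e)).
  apply: fin_bigcap_measurable => // i _.
  rewrite -[X in measurable X]setTI; apply: measurable_rV_coord => //.
  by rewrite ball_itv; exact: measurable_itv.
apply/seteqP; split => [y /mx_ballE[_ h] i _|y h]; first exact: h.
by apply/mx_ballE; split => // i; exact: (h i Logic.I).
Qed.

(** An open set is the union of the balls it contains that have rational centre and radius 1/(k+1);
    there are countably many, and each is a box since the norm is the sup norm. *)
Lemma measurable_rV_open (U : set 'rV[R]_n) : open U -> measurable U.
Proof.
move=> oU.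
pose q (v : 'rV[rat]_n) : 'rV[R]_n := \row_i ratr (v 0 i).
pose B (p : 'rV[rat]_n * nat) := ball (q p.1) (p.2.+1%:R^-1 : R).
have -> : U = \bigcup_(p in [set p | B p `<=` U]) B p.
  apply/seteqP; split => [x Ux|x [p]]; last exact.
  have /nbhs_ballP[e /= e0 xeU] := open_nbhs_nbhs (conj oU Ux).
  (* With 1/(k+1) < e/2, any ball of this radius containing x lies in the ball of radius e about
     x. *)
  pose k := Num.truncn (2 / e).
  have ke : k.+1%:R^-1 < e / 2.
    rewrite -[ltRHS]invrK ltf_pV2 ?posrE ?invr_gt0 ?divr_gt0// invf_div.
    by rewrite truncnS_gt.
  have k0 : (0 : R) < k.+1%:R^-1 by rewrite invr_gt0.
  have h i : exists r : rat, `|ratr r - x 0 i| < k.+1%:R^-1.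
    have /rat_in_itvoo[r] : x 0 i < x 0 i + k.+1%:R^-1 by rewrite ltrDl.
    rewrite in_itv/= => /andP[r1 r2]; exists r.
    by rewrite ltr_norml ltrBlDl r2 andbT (lt_trans _ (_ : 0 < _)) ?oppr_lt0 ?subr_gt0.
  have [f fP] := choice h.
  have Bx : B (\row_i f i, k) x.
    apply/mx_ballE; split => // i.
    by rewrite !mxE.
  exists (\row_i f i, k) => //= y /= Byz; apply: xeU.
  move/mx_ballE : Byz => [_ hy]; move/mx_ballE : Bx => [_ hx].
  apply/mx_ballE; split => // i.
  have := hx i; have := hy i; rewrite /= => h1 h2.
  rewrite (_ : x 0 i - y 0 i = (x 0 i - q (\row_i f i) 0 i) + (q (\row_i f i) 0 i - y 0 i)); last by ring.
  rewrite (le_lt_trans (ler_normD _ _))// distrC (splitr e) ltrD//.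
  exact: lt_trans ke.
exact: lt_trans ke.
rewrite bigcup_mkcond; apply: countable_bigcupT_measurable => [|p].
  exact: countableP.
by case: ifP => // _; exact: measurable_rV_ball.
Qed.

Lemma continuous_measurable_rV (f : 'rV[R]_n -> R) :
  continuous f -> measurable_fun setT f.
Proof.
move=> /continuousP cf; apply: (measurability _ (RGenOpens.measurableE R)).
move=> _ [_ [a [b ->]] <-]; rewrite setTI; apply: measurable_rV_open; apply: cf.
exact: interval_open.
Qed.

Lemma measurable_dotp d (T : measurableType d) (f g : T -> 'rV[R]_n) :
  measurable_fun setT f -> measurable_fun setT g ->
  measurable_fun setT (fun t => dotp (f t) (g t)).
Proof.
move=> mf mg; rewrite /dotp; apply: measurable_sum => i.
by apply: measurable_funM;
  apply: (measurableT_comp (@measurable_rV_coord R n i)).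
Qed.

Lemma measurable_enorm : measurable_fun setT (@enorm R n).
Proof.
apply: measurableT_comp; last by apply: measurable_dotp.
by apply: continuous_measurable_fun; exact: sqrt_continuous.
Qed.

Lemma enorm_ge0 (x : 'rV[R]_n) : 0 <= enorm x.
Proof. exact: sqrtr_ge0. Qed.

End rV_measurability.

(** * Integration on R^n: Tonelli and Fubini one coordinate at a time, tensor products,
    translations *)

Section rV_integral.
Variable R : realType.
Local Open Scope ereal_scope.

(** R^0 is one point of mass 1, where every function is measurable; inductions on the dimension
    start here. *)
Lemma ge0_integral_rV0 (f : 'rV[R]_0 -> \bar R) :
  \int[lebesgue_rV]_x f x = f 0%R.
Proof.
rewrite [LHS](_ : _ = \int[dirac (0%R : 'rV[R]_0)]_x f x)//.
rewrite integral_dirac// ?diracT ?mul1e//.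
move=> _ Y mY; rewrite setTI.
have [Y0|Y0] := pselect ((f @^-1` Y) 0%R).
  rewrite (_ : _ @^-1` _ = setT) //; apply/seteqP; split => // x _.
  by rewrite (_ : x = 0%R) //; apply/rowP => -[].
rewrite (_ : _ @^-1` _ = set0) //; apply/seteqP; split => // x /= fx.
by apply: Y0; rewrite (_ : 0%R = x) //; apply/rowP => -[].
Qed.

Lemma ge0_integral_rV_cons n (f : 'rV[R]_n.+1 -> \bar R) :
  measurable_fun setT f -> (forall x, 0 <= f x) ->
  \int[lebesgue_rV]_x f x =
  \int[lebesgue_measure]_a \int[lebesgue_rV]_v f (rV_cons (a, v)).
Proof.
move=> mf f0.
rewrite [LHS](_ : _ =
  \int[pushforward (lebesgue_measure \x @lebesgue_rV R n) (@rV_cons R n)]_x f x)//.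
rewrite ge0_integral_pushforward//; last exact: measurable_rV_cons.
rewrite preimage_setT fubini_tonelli1//.
  by apply: measurableT_comp => //; exact: measurable_rV_cons.
by move=> p; exact: f0.
Qed.

Lemma integrable_rV_cons n (f : 'rV[R]_n.+1 -> \bar R) :
  measurable_fun setT f ->
  lebesgue_rV.-integrable setT f <->
  (lebesgue_measure \x @lebesgue_rV R n).-integrable setT (f \o @rV_cons R n).
Proof.
move=> mf; split.
  move=> /integrableP[_ foo]; apply/integrableP; split.
    by apply: measurableT_comp => //; exact: measurable_rV_cons.
  move: foo; rewrite [X in X < _ -> _](_ : _ =
   \int[pushforward (lebesgue_measure \x @lebesgue_rV R n) (@rV_cons R n)]_x `|f x|)//.
  rewrite ge0_integral_pushforward//; first exact: measurable_rV_cons.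
  exact: measurableT_comp.
move=> /integrableP[_ foo]; apply/integrableP; split => //.
move: foo; rewrite [X in _ -> X < _](_ : _ =
 \int[pushforward (lebesgue_measure \x @lebesgue_rV R n) (@rV_cons R n)]_x `|f x|)//.
rewrite ge0_integral_pushforward//; first exact: measurable_rV_cons.
exact: measurableT_comp.
Qed.

Lemma integral_rV_cons n (f : 'rV[R]_n.+1 -> \bar R) :
  lebesgue_rV.-integrable setT f ->
  \int[lebesgue_rV]_x f x =
  \int[lebesgue_measure]_a \int[lebesgue_rV]_v f (rV_cons (a, v)).
Proof.
move=> fi; have [mf _] := integrableP _ _ _ fi.
have fi2 := (integrable_rV_cons mf).1 fi.
rewrite [LHS](_ : _ =
  \int[pushforward (lebesgue_measure \x @lebesgue_rV R n) (@rV_cons R n)]_x f x)//.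
rewrite (integral_pushforward (@measurable_rV_cons R n))//.
by rewrite preimage_setT -integral12_prod_meas1.
Qed.

Lemma ge0_integral_rV_prod n (p : 'I_n -> R -> R) :
  (forall i, measurable_fun setT (p i)) -> (forall i a, (0 <= p i a)%R) ->
  \int[lebesgue_rV]_x (\prod_(i < n) p i (x 0 i))%:E =
  \prod_(i < n) \int[lebesgue_measure]_a (p i a)%:E.
Proof.
have mprod m (q : 'I_m -> R -> R) : (forall i, measurable_fun setT (q i)) ->
    measurable_fun setT (fun x : 'rV[R]_m => \prod_(i < m) q i (x 0 i))%R.
  move=> mq; apply: measurable_prod => i _.
  by apply: (measurableT_comp (mq i)); exact: measurable_rV_coord.
elim: n p => [|n IHn] p mp p0.
  by rewrite ge0_integral_rV0 !big_ord0.
rewrite big_ord_recl -IHn// ge0_integral_rV_cons//; first last.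
- by move=> x; rewrite lee_fin prodr_ge0.
- by apply/measurable_EFinP; exact: mprod.
rewrite -ge0_integralZr//; first last.
- by apply: integral_ge0 => x _; rewrite lee_fin prodr_ge0.
- by move=> a _; rewrite lee_fin.
- by apply/measurable_EFinP; exact: mp.
apply: eq_integral => a _.
rewrite -ge0_integralZl//; first last.
- by rewrite lee_fin.
- by move=> x _; rewrite lee_fin prodr_ge0.
- by apply/measurable_EFinP; exact: (mprod n (fun i => p (lift ord0 i))).
apply: eq_integral => v _; rewrite -EFinM big_ord_recl rV_cons0.
by under eq_bigr do rewrite rV_consS.
Qed.

(** The translated measure agrees with Lebesgue measure on half-open intervals, so the two coincide
    by uniqueness. *)
Lemma ge0_integral_shift (h : R) (f : R -> \bar R) :
  measurable_fun setT f -> (forall a, 0 <= f a) ->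
  \int[lebesgue_measure]_a f (a + h)%R = \int[lebesgue_measure]_a f a.
Proof.
move=> mf f0.
pose sh : measurableTypeR R -> measurableTypeR R := fun a => (a + h)%R.
have ms : measurable_fun setT sh by exact: measurable_funD.
have [nu nuE] : exists nu : {measure set (measurableTypeR R) -> \bar R},
    nu = pushforward lebesgue_measure sh :> (set _ -> \bar R).
  by exists (pushforward lebesgue_measure sh).
transitivity (\int[nu]_a f a).
  by rewrite nuE (ge0_integral_pushforward ms).
apply: eq_measure_integral => A mA _; apply/esym; apply: lebesgue_measure_unique => //.
move=> _ [[a b] _ <-].
rewrite nuE /pushforward lebesgue_measure_itv/=.
rewrite (_ : _ @^-1` _ = [set` `](a - h)%R, (b - h)%R]]); last first.
  by apply/seteqP; split => c /=; rewrite !in_itv/= ltrBlDr lerBrDr.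
rewrite lebesgue_measure_itv/= !lte_fin ltrD2r; case: ifP => // _.
by rewrite -!EFinB; congr EFin; ring.
Unshelve. exact: ms.
Qed.

Lemma ge0_integral_rV_shift n (h : 'rV[R]_n) (f : 'rV[R]_n -> \bar R) :
  measurable_fun setT f -> (forall x, 0 <= f x) ->
  \int[lebesgue_rV]_x f (x + h)%R = \int[lebesgue_rV]_x f x.
Proof.
have madd m (k : 'rV[R]_m) : measurable_fun setT (fun x : 'rV[R]_m => x + k)%R.
  apply: measurable_to_rV => i.
  rewrite (_ : _ \o _ = (fun x => @rV_coord R m i x + k 0 i)%R).
    by apply: measurable_funD => //; exact: measurable_rV_coord.
  by apply/funext => x; rewrite /= /rV_coord mxE.
elim: n h f => [|n IHn] h f mf f0.
  by rewrite !ge0_integral_rV0; congr f; apply/rowP => -[].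
rewrite !ge0_integral_rV_cons//; last first.
  by apply: measurableT_comp => //; exact: madd.
pose g a := \int[lebesgue_rV]_v f (rV_cons (a, v)).
have mfc : measurable_fun setT (f \o @rV_cons R n).
  by apply: measurableT_comp => //; exact: measurable_rV_cons.
rewrite -[RHS](ge0_integral_shift (h 0%R ord0)); first last.
- by move=> a; exact: integral_ge0.
- by apply: (measurable_fun_fubini_tonelli_F (f \o @rV_cons R n) mfc) => p; exact: f0.
apply: eq_integral => a _.
rewrite -(IHn (\row_i h 0%R (lift ord0 i)) (fun v => f (rV_cons ((a + h 0 ord0)%R, v))))//.
- apply: eq_integral => v _; congr f; apply/rowP => i.
  case: (unliftP ord0 i) => [j ->|->]; rewrite [LHS]mxE.
    by rewrite !rV_consS/= !mxE.
  by rewrite !rV_cons0.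
- exact: (measurableT_comp mfc (pair1_measurable _)).
Qed.

End rV_integral.

(** * Domination and Fubini for real-valued integrals *)

Section Rintegral_domination.
Context d (T : measurableType d) (R : realType) (mu : {measure set T -> \bar R}).
Implicit Types f g : T -> R.

Lemma integrable_dominated f g :
  measurable_fun setT f -> mu.-integrable setT (EFin \o g) ->
  (forall x, `|f x| <= g x) -> mu.-integrable setT (EFin \o f).
Proof.
move=> mf gi fg; apply: le_integrable gi => //; first exact/measurable_EFinP.
by move=> x _ /=; rewrite lee_fin (le_trans (fg x))// ler_norm.
Qed.

Lemma EFin_Rintegral f : mu.-integrable setT (EFin \o f) ->
  (\int[mu]_x f x)%:E = (\int[mu]_x (f x)%:E)%E.
Proof. by move=> fi; rewrite /Rintegral fineK//; exact: integrable_fin_num. Qed.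

Lemma normr_Rintegral_le f g :
  measurable_fun setT f -> mu.-integrable setT (EFin \o g) ->
  (forall x, `|f x| <= g x) -> `|\int[mu]_x f x| <= \int[mu]_x g x.
Proof.
move=> mf gi fg; have fi := integrable_dominated mf gi fg.
rewrite (le_trans (le_normr_Rintegral _ fi))//.
apply: le_Rintegral => //.
by apply: (integrable_dominated _ gi) => [|x]; [exact: measurableT_comp|
  rewrite normr_id].
Qed.

Lemma integrable_bounded_mul f g (M : R) :
  measurable_fun setT f -> (forall x, `|f x| <= M) ->
  mu.-integrable setT (EFin \o g) -> mu.-integrable setT (EFin \o (fun x => f x * g x)).
Proof.
move=> mf fM gi.
have M0 : mu.-integrable setT (EFin \o (fun x => M * `|g x|)).
  apply: (@integrableZl _ _ _ _ _ measurableT M (abse \o (EFin \o g))).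
  exact: integrable_abse.
apply: integrable_dominated M0 _.
  apply: measurable_funM => //.
  by have /integrableP[/measurable_EFinP] := gi.
by move=> x; rewrite normrM ler_wpM2r.
Qed.

End Rintegral_domination.

(** Tonelli's measurability statement is applied to the positive and the negative part
    separately. *)
Lemma measurable_Rintegral_param d1 d2 (T1 : measurableType d1)
    (T2 : measurableType d2) (R : realType)
    (m2 : {sigma_finite_measure set T2 -> \bar R}) (g : T1 -> T2 -> R) :
  measurable_fun setT (fun z => g z.1 z.2) ->
  measurable_fun setT (fun x => \int[m2]_y g x y).
Proof.
move=> mg; have mgE : measurable_fun setT (fun z => (g z.1 z.2)%:E).
  exact/measurable_EFinP.
rewrite /Rintegral; apply: (measurableT_comp (fine_measurable measurableT)).
rewrite (_ : (fun x => _) = (fun x =>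
    \int[m2]_y (fun z => (g z.1 z.2)%:E)^\+ (x, y) -
    \int[m2]_y (fun z => (g z.1 z.2)%:E)^\- (x, y))%E); last first.
  apply/funext => x; rewrite integralE.
  by congr (_ - _)%E; apply: eq_integral => y _; rewrite ?funeposE ?funenegE.
apply: emeasurable_funB; apply: (@measurable_fun_fubini_tonelli_F _ _ _ _ _ m2 _).
- exact: measurable_funepos.
- by move=> z; exact: funepos_ge0.
- exact: measurable_funeneg.
- by move=> z; exact: funeneg_ge0.
Qed.

Section product_domination.
Context d1 d2 (T1 : measurableType d1) (T2 : measurableType d2) (R : realType).
Variables (m1 : {sigma_finite_measure set T1 -> \bar R}).
Variables (m2 : {sigma_finite_measure set T2 -> \bar R}).
Variables (g : T1 -> T2 -> R) (p : T1 -> R) (q : T2 -> R).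
Hypothesis mg : measurable_fun setT (fun z => g z.1 z.2).
Hypothesis pi : m1.-integrable setT (EFin \o p).
Hypothesis qi : m2.-integrable setT (EFin \o q).
Hypothesis gpq : forall x y, `|g x y| <= p x * q y.

Let mgE : measurable_fun setT (fun z => (g z.1 z.2)%:E).
Proof. exact/measurable_EFinP. Qed.

Lemma product_dominated_section x : m2.-integrable setT (EFin \o g x).
Proof.
apply: (integrable_dominated (g := fun y => p x * q y)) => //.
  exact: (measurableT_comp mg (pair1_measurable x)).
exact: (@integrableZl _ _ _ _ _ measurableT (p x) (EFin \o q)).
Qed.

(** Tonelli computes the integral of p(x) q(y) as a product of two finite integrals; every later use
    of Fubini comes with such a product bound. *)
Lemma product_dominated_integrable :
  (m1 \x m2)%E.-integrable setT (fun z => (g z.1 z.2)%:E).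
Proof.
apply/integrable12ltyP => //=.
have mp : measurable_fun setT p by have /integrableP[/measurable_EFinP] := pi.
have mq : measurable_fun setT q by have /integrableP[/measurable_EFinP] := qi.
have /integrableP[_ poo] := pi; have /integrableP[_ qoo] := qi.
apply: (@le_lt_trans _ _
    (\int[m1]_x (`|p x|%:E * \int[m2]_y `|q y|%:E))%E); last first.
  rewrite ge0_integralZr//.
  - by apply: lte_mul_pinfty => //; [exact: integral_ge0|
      rewrite ge0_fin_numE//; exact: integral_ge0].
  - by apply/measurable_EFinP; exact: measurableT_comp.
  - exact: integral_ge0.
apply: ge0_le_integral => //.
- by move=> x _; exact: integral_ge0.
- by apply: (measurable_fun_fubini_tonelli_F (fun z => `|(g z.1 z.2)%:E|%E)) => //;
    exact: measurableT_comp.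
- apply: emeasurable_funM => //; apply/measurable_EFinP; exact: measurableT_comp.
move=> x _; rewrite -ge0_integralZl//; first last.
- by apply/measurable_EFinP; exact: measurableT_comp.
apply: ge0_le_integral => //.
- apply/measurable_EFinP; apply: measurableT_comp => //.
  exact: (measurableT_comp mg (pair1_measurable x)).
- apply: emeasurable_funM => //; apply/measurable_EFinP; exact: measurableT_comp.
by move=> y _; rewrite lee_fin -normrM (le_trans (gpq x y))// ler_norm.
Qed.

Let F x := (\int[m2]_y (g x y)%:E)%E.

Let FE : (fun x => F x) = EFin \o (fun x => \int[m2]_y g x y).
Proof.
apply/funext => x; rewrite /= EFin_Rintegral//; exact: product_dominated_section.
Qed.

Lemma integrable_Rintegral_section :
  m1.-integrable setT (EFin \o (fun x => \int[m2]_y g x y)).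
Proof.
rewrite -FE.
exact: (integrable_fubini_F product_dominated_integrable).
Qed.

Lemma Rintegral_section_prod : \int[m1]_x \int[m2]_y g x y =
  fine (\int[(m1 \x m2)%E]_z (g z.1 z.2)%:E)%E.
Proof.
rewrite {1}/Rintegral; congr fine.
rewrite -(integral12_prod_meas1 product_dominated_integrable).
by apply: eq_integral => x _; have := congr1 (@^~ x) FE => /= <-.
Qed.

End product_domination.

Lemma Rintegral_exchange d1 d2 (T1 : measurableType d1) (T2 : measurableType d2)
    (R : realType) (m1 : {sigma_finite_measure set T1 -> \bar R})
    (m2 : {sigma_finite_measure set T2 -> \bar R})
    (g : T1 -> T2 -> R) (p : T1 -> R) (q : T2 -> R) :
  measurable_fun setT (fun z => g z.1 z.2) ->
  m1.-integrable setT (EFin \o p) -> m2.-integrable setT (EFin \o q) ->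
  (forall x y, `|g x y| <= p x * q y) ->
  \int[m1]_x \int[m2]_y g x y = \int[m2]_y \int[m1]_x g x y.
Proof.
move=> mg ip iq gpq.
rewrite (Rintegral_section_prod mg ip iq gpq).
have ms : measurable_fun setT (fun z : T2 * T1 => g z.2 z.1).
  by apply: (measurableT_comp mg (@measurable_swap _ _ T2 T1)).
have gqp y x : `|g x y| <= q y * p x by rewrite mulrC.
rewrite (Rintegral_section_prod (g := fun y x => g x y) ms iq ip gqp).
congr fine.
have gi := product_dominated_integrable mg ip iq gpq.
have gi' := product_dominated_integrable (g := fun y x => g x y) ms iq ip gqp.
by rewrite -(integral21_prod_meas1 gi) -(integral12_prod_meas1 gi').
Qed.

(** * A one-dimensional cut-off and the Cauchy kernel that dominates its Fourier transform *)

Section cauchy_kernel.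
Variable R : realType.
Implicit Types M a b : R.

(** The Cauchy density dilated by M, normalised to have integral pi whatever M is. *)
Definition cauchy M a : R := M / (1 + (M * a) ^+ 2).

Lemma cauchy_ge0 M a : 0 < M -> 0 <= cauchy M a.
Proof. by move=> M0; rewrite divr_ge0 ?(ltW M0)// addr_ge0// sqr_ge0. Qed.

Lemma cauchy_den_gt0 M a : 0 < 1 + (M * a) ^+ 2.
Proof. by rewrite ltr_pwDl// sqr_ge0. Qed.

Lemma continuous_cauchy M : continuous (cauchy M).
Proof.
move=> a; apply: cvgM; first exact: cvg_cst.
apply: cvgV; first by rewrite gt_eqF// cauchy_den_gt0.
apply: cvgD; first exact: cvg_cst.
by apply: cvgM; apply: cvgM; (try exact: cvg_cst); exact: cvg_id.
Qed.

Lemma measurable_cauchy M : measurable_fun setT (cauchy M).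
Proof. by apply: continuous_measurable_fun; exact: continuous_cauchy. Qed.

Lemma is_derive_atan_scale M a : is_derive a 1 (fun b => atan (M * b)) (cauchy M a).
Proof.
have h : is_derive a 1 (fun b => M * b) M.
  by have := is_deriveZ M (is_derive_id a 1); rewrite /GRing.scale/= mulr1.
by apply: is_derive_eq; rewrite mulrC.
Qed.

(** The kernel is even and has the antiderivative atan(M b), which runs from 0 to pi/2 on the
    half-line. *)
Lemma integral_cauchy M : 0 < M ->
  (\int[lebesgue_measure]_a (cauchy M a)%:E = pi%:E)%E.
Proof.
move=> M0; rewrite ge0_symfun_integralT; first last.
- by move=> a; rewrite /cauchy/= mulrN sqrrN.
- exact: continuous_cauchy.
- by move=> a; exact: cauchy_ge0.
rewrite -set_itvcy (@ge0_continuous_FTC2y _ _ (fun b => atan (M * b)) _ (pi / 2)).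
- by rewrite mulr0 atan0 sube0 -EFinM mulrC divfK.
- by move=> x _; exact: cauchy_ge0.
- by apply: continuous_subspaceT; exact: continuous_cauchy.
- apply: (cvg_comp _ _ _ (@cvgy_atan R)).
  exact: gt0_cvgMry.
- by move=> x _; have [] := is_derive_atan_scale M x.
- apply: cvg_at_right_filter; apply: differentiable_continuous.
  by apply/derivable1_diffP; have [] := is_derive_atan_scale M 0.
- by move=> x _; rewrite derive1E; have [_ ->] := is_derive_atan_scale M x.
Qed.

Lemma integral_cauchy_shift M b : 0 < M ->
  (\int[lebesgue_measure]_a (cauchy M (b - a))%:E = pi%:E)%E.
Proof.
move=> M0; rewrite -(integral_cauchy M0) -[RHS](ge0_integral_shift (- b)).
- by apply: eq_integral => a _; rewrite /cauchy -(opprB a b) mulrN sqrrN.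
- by apply/measurable_EFinP; exact: measurable_cauchy.
- by move=> a; rewrite lee_fin cauchy_ge0.
Qed.

End cauchy_kernel.

Section parabolic_weight.
Variable R : realType.
Implicit Types M x z c : R.

(** A cut-off to [-M, M] that is continuous at the end points: this makes its Fourier transform
    decay quadratically, hence integrable, while antiderivatives stay explicit. *)
Definition parab M x : R := Num.max 0 (1 - (x / M) ^+ 2).

Lemma parab_ge0 M x : 0 <= parab M x.
Proof. by rewrite le_max lexx. Qed.

Lemma parab_le1 M x : parab M x <= 1.
Proof. by rewrite ge_max ler01/= gerBl sqr_ge0. Qed.

Lemma measurable_parab M : measurable_fun setT (parab M).
Proof.
apply: measurable_maxr; first exact: measurable_cst.
apply: measurable_funB; first exact: measurable_cst.
by apply: measurable_funX; apply: measurable_funM => //; exact: measurable_cst.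
Qed.

Lemma parab_patch M x (f : R -> R) : 0 < M ->
  parab M x * f x = ((fun y => (1 - (y / M) ^+ 2) * f y) \_ `[- M, M]) x.
Proof.
move=> M0; rewrite patchE /parab.
have xM : (x \in `[- M, M]%classic) = (0 <= 1 - (x / M) ^+ 2).
  rewrite subr_ge0 -[in RHS]real_normK ?num_real// expr_le1// normf_div.
  rewrite (gtr0_norm M0) ler_pdivrMr// mul1r.
  by apply/idP/idP; rewrite inE/= in_itv/= -ler_norml.
by rewrite xM; case: leP; rewrite ?mul0r.
Qed.

Lemma integrable_parab M : 0 < M ->
  lebesgue_measure.-integrable setT (EFin \o parab M).
Proof.
move=> M0; apply: (@integrable_dominated _ _ _ lebesgue_measure _ (\1_(`[- M, M]%classic))).
- exact: measurable_parab.
- have -> : EFin \o \1_(`[- M, M]%classic) =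
      (fun x : measurableTypeR R => (\1_(`[- M, M]%classic) x)%:E) by [].
  apply/integrableP; split; first exact/measurable_EFinP.
  under eq_integral do rewrite gee0_abs ?lee_fin//.
  rewrite integral_indic// setIT/= lebesgue_measure_itv/=; case: ifP => _; last exact: ltry.
  by rewrite -EFinB ltry.
- move=> x; rewrite ger0_norm ?parab_ge0// -[parab M x]mulr1.
  rewrite (parab_patch x (cst 1) M0) patchE indicE; case: ifP => //= _.
  by rewrite mulr1 gerBl sqr_ge0.
Qed.

End parabolic_weight.

Section parabolic_transform.
Variable R : realType.
Implicit Types M x z c : R.

Lemma Rintegral_FTC2 (f F : R -> R) (a b : R) : a < b -> continuous f ->
  (forall x, is_derive x 1 F (f x)) ->
  \int[lebesgue_measure]_(x in `[a, b]) f x = F b - F a.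
Proof.
move=> ab cf dF.
have cF : continuous F.
  move=> x; apply: differentiable_continuous; apply/derivable1_diffP.
  by have [] := dF x.
rewrite /Rintegral (@continuous_FTC2 _ f F)//.
- exact: continuous_subspaceT.
- split; first by move=> x _; have [] := dF x.
  + by apply: cvg_at_right_filter; exact: cF.
  + by apply: cvg_at_left_filter; exact: cF.
- by move=> x _; rewrite derive1E; have [_ ->] := dF x.
Qed.

Let is_derive_affine z c x : is_derive x 1 (fun y => z * y + c) z.
Proof.
have h := is_deriveD (is_deriveZ z (is_derive_id x 1)) (is_derive_cst c x 1).
by move: h; rewrite /GRing.scale/= mulr1 addr0.
Qed.

(** The free phase c covers the cosine and the sine transform at once, and lets the computation be
    iterated over coordinates. *)
Definition parab_cos M z c : R :=
  \int[lebesgue_measure]_x (parab M x * cos (z * x + c)).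

Definition parab_hat M z : R := parab_cos M z 0.

Let parab_cosE M z c : 0 < M -> z != 0 -> parab_cos M z c =
  cos c * (4 * sin (z * M) / (M ^+ 2 * z ^+ 3) - 4 * cos (z * M) / (M * z ^+ 2)).
Proof.
move=> M0 z0; have M0' : M != 0 by rewrite gt_eqF.
pose f x := (1 - (x / M) ^+ 2) * cos (z * x + c).
(* For p = 1 - (x/M)^2, repeated integration by parts gives the antiderivative p sin/z + p' cos/z^2
   - p'' sin/z^3. *)
pose G x := (1 - (x / M) ^+ 2) * (sin (z * x + c) / z)
  - (2 * x / M ^+ 2) * (cos (z * x + c) / z ^+ 2)
  + 2 / M ^+ 2 * (sin (z * x + c) / z ^+ 3).
have -> : parab_cos M z c = \int[lebesgue_measure]_(x in `[- M, M]) f x.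
  rewrite [RHS]Rintegral_mkcond; apply: eq_Rintegral => x _.
  exact: (parab_patch x (fun x => cos (z * x + c)) M0).
have dG x : is_derive x 1 G (f x).
  have := is_derive_affine z c x => dz.
  have dc : is_derive x 1 (fun y => cos (z * y + c)) (- sin (z * x + c) * z).
    exact: (@is_derive1_comp _ cos (fun y => z * y + c)).
  have ds : is_derive x 1 (fun y => sin (z * y + c)) (cos (z * x + c) * z).
    exact: (@is_derive1_comp _ sin (fun y => z * y + c)).
  rewrite /G.
  have -> : (fun y => (1 - (y / M) ^+ 2) * (sin (z * y + c) / z)
      - (2 * y / M ^+ 2) * (cos (z * y + c) / z ^+ 2)
      + 2 / M ^+ 2 * (sin (z * y + c) / z ^+ 3)) =
    (cst 1 - (M ^- 2 *: (id : R -> R)) * id) * (z^-1 *: (fun y => sin (z * y + c)))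
      - ((2 / M ^+ 2) *: (id : R -> R)) * (z ^- 2 *: (fun y => cos (z * y + c)))
      + (2 / M ^+ 2 / z ^+ 3) *: (fun y => sin (z * y + c)).
    apply/funext => y; rewrite !fctE /GRing.scale/=.
    move: (sin _) (cos _) => s0 c0; field.
    by rewrite z0 M0'.
  apply: is_derive_eq; rewrite /f /GRing.scale/= !fctE /GRing.scale/=.
  rewrite -[M ^- 2 *: x]/(M ^- 2 * x).
  move: (sin _) (cos _) => s0 c0; field.
  by rewrite z0 M0'.
rewrite (Rintegral_FTC2 _ _ dG); first last.
- move=> x; apply: differentiable_continuous; apply/derivable1_diffP.
  by rewrite /f; apply: ex_derive.
- by rewrite (@lt_trans _ _ 0)// oppr_lt0.
rewrite /G mulrN !mulNr divff// expr1n sqrrN expr1n subrr !mul0r !add0r.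
rewrite !sinD !cosD sinN cosN.
by field; rewrite z0 M0'.
Qed.

(** The cut-off is even, so in cos(z x + c) only the product cos(z x) cos c contributes. In the
    proof this is read off the closed formula, and z = 0 is treated apart because that formula
    divides by z. *)
Lemma parab_cos_hat M z c : 0 < M -> parab_cos M z c = parab_hat M z * cos c.
Proof.
move=> M0; have [->|z0] := eqVneq z 0; last first.
  by rewrite /parab_hat !parab_cosE// cos0 mul1r mulrC.
rewrite /parab_hat /parab_cos.
under eq_Rintegral do rewrite mul0r add0r.
under [in RHS]eq_Rintegral do rewrite mul0r add0r cos0 mulr1.
by rewrite RintegralZr//; exact: integrable_parab.
Qed.

(** For |M z| <= 1 the integral 4M/3 of the cut-off suffices, the denominator being at most 2. For t
    = (M z)^2 > 1 the closed formula gives 8M/t, and 1 + t <= 2t. *)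
Lemma parab_hat_bound M z : 0 < M -> `|parab_hat M z| <= 16 * cauchy M z.
Proof.
move=> M0.
have den := cauchy_den_gt0 M z.
have [Mz|Mz] := leP `|M * z| 1.
  have h : `|parab_hat M z| <= 2 * M.
    apply: (@le_trans _ _ (\int[lebesgue_measure]_x parab M x)).
      apply: normr_Rintegral_le.
      - apply: measurable_funM; first exact: measurable_parab.
        apply: measurableT_comp; first by apply: continuous_measurable_fun; exact: continuous_cos.
        by apply: measurable_funD => //; exact: measurable_funM.
      - exact: integrable_parab.
      - move=> x; rewrite normrM ger0_norm ?parab_ge0//.
        by rewrite ler_piMr ?parab_ge0// ler_norml cos_geN1 cos_le1.
    have -> : \int[lebesgue_measure]_x parab M x = \int[lebesgue_measure]_(x in `[- M, M]) (1 - (x / M) ^+ 2).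
      rewrite [RHS]Rintegral_mkcond; apply: eq_Rintegral => x _.
      rewrite -[LHS]mulr1 (parab_patch x (cst 1) M0) !patchE; case: ifP => //= _.
      by rewrite mulr1.
    have M0' : M != 0 by rewrite gt_eqF.
    have dF x : is_derive x 1 (fun x => x - (3 * M ^+ 2)^-1 * x ^+ 3) (1 - (x / M) ^+ 2).
      have -> : (fun x => x - (3 * M ^+ 2)^-1 * x ^+ 3) =
          id - (3 * M ^+ 2)^-1 *: (fun x : R => x ^+ 3).
        by apply/funext.
      apply: is_derive_eq; rewrite /GRing.scale/=.
      by field.
    rewrite (Rintegral_FTC2 _ _ dF).
    - rewrite (_ : _ - _ = 4 / 3 * M); first by rewrite ler_wpM2r ?ltW//; lra.
      by field.
    - by rewrite (@lt_trans _ _ 0)// oppr_lt0.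
    - move=> x; apply: cvgB; first exact: cvg_cst.
      by apply: cvgM; apply: cvgM; (try exact: cvg_cst); exact: cvg_id.
  rewrite (le_trans h)// /cauchy mulrA ler_pdivlMr//.
  have : (M * z) ^+ 2 <= 1 by rewrite -real_normK ?num_real// expr_le1.
  by move: ((M * z) ^+ 2) => t t1; nra.
have z0 : z != 0 by apply: contraTneq Mz => ->; rewrite mulr0 normr0 ltr10.
have Mz0 : 0 < `|M * z| by rewrite (lt_trans _ Mz).
have M0' : M != 0 by rewrite gt_eqF.
rewrite /parab_hat parab_cosE// cos0 mul1r.
have -> : 4 * sin (z * M) / (M ^+ 2 * z ^+ 3) - 4 * cos (z * M) / (M * z ^+ 2) =
  (sin (z * M) / (M * z) - cos (z * M)) * (4 * M / (M * z) ^+ 2).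
  by field; rewrite z0 M0'.
rewrite normrM.
have h1 : `|sin (z * M) / (M * z) - cos (z * M)| <= 2.
  apply: (le_trans (ler_normB _ _)).
  have hs : `|sin (z * M) / (M * z)| <= 1.
    rewrite normf_div ler_pdivrMr// mul1r (le_trans _ (ltW Mz))//.
    by rewrite ler_norml sin_geN1 sin_le1.
  have hc : `|cos (z * M)| <= 1 by rewrite ler_norml cos_geN1 cos_le1.
  lra.
have sq1 : 1 <= (M * z) ^+ 2 by rewrite -real_normK ?num_real// expr_ge1// ltW.
rewrite (ger0_norm (_ : 0 <= 4 * M / (M * z) ^+ 2)); last first.
  by rewrite divr_ge0 ?sqr_ge0// mulr_ge0// ltW.
apply: (@le_trans _ _ (2 * (4 * M / (M * z) ^+ 2))).
  by rewrite ler_wpM2r// divr_ge0 ?sqr_ge0// mulr_ge0// ltW.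
rewrite /cauchy; move: ((M * z) ^+ 2) sq1 => t t1; rewrite -subr_ge0.
have t0 : 0 < t by rewrite (lt_le_trans _ t1).
have -> : 16 * (M / (1 + t)) - 2 * (4 * M / t) = 8 * M * (t - 1) / (t * (1 + t)).
  by field; rewrite !gt_eqF// ltr_pwDl// ltW.
by rewrite divr_ge0// mulr_ge0 ?subr_ge0// ?addr_ge0// ?mulr_ge0// ltW.
Qed.

End parabolic_transform.

(** * Trigonometric bounds and the dot product *)

Section bounded_trigonometry.
Variable R : realType.

Lemma normr_cos_le1 (x : R) : `|cos x| <= 1.
Proof. by rewrite ler_norml cos_geN1 cos_le1. Qed.

Lemma normr_sin_le1 (x : R) : `|sin x| <= 1.
Proof. by rewrite ler_norml sin_geN1 sin_le1. Qed.

Lemma measurable_funcos d (T : measurableType d) (f : T -> R) :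
  measurable_fun setT f -> measurable_fun setT (fun t => cos (f t)).
Proof.
move=> mf; apply: measurableT_comp mf.
by apply: continuous_measurable_fun; exact: continuous_cos.
Qed.

Lemma measurable_funsin d (T : measurableType d) (f : T -> R) :
  measurable_fun setT f -> measurable_fun setT (fun t => sin (f t)).
Proof.
move=> mf; apply: measurableT_comp mf.
by apply: continuous_measurable_fun; exact: continuous_sin.
Qed.

End bounded_trigonometry.

Section dotp_algebra.
Variables (R : realType) (n : nat).
Implicit Types x y z : 'rV[R]_n.

Lemma dotpC x y : dotp x y = dotp y x.
Proof. by rewrite /dotp; under eq_bigr do rewrite mulrC. Qed.

Lemma dotpBl x y z : dotp (x - y) z = dotp x z - dotp y z.
Proof.
by rewrite /dotp -sumrB; apply: eq_bigr => i _; rewrite !mxE mulrBl.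
Qed.

Lemma dotp_cons (a b : R) x y :
  dotp (rV_cons (a, x)) (rV_cons (b, y)) = a * b + dotp x y.
Proof.
rewrite /dotp big_ord_recl !rV_cons0; congr (_ + _).
by apply: eq_bigr => i _; rewrite !rV_consS.
Qed.

End dotp_algebra.

(** * Tensor powers of the cut-off and of the Cauchy kernel on R^n *)

Section rV_weight.
Variable R : realType.

Lemma measurable_rV_prod n (p : 'I_n -> R -> R) :
  (forall i, measurable_fun setT (p i)) ->
  measurable_fun setT (fun x : 'rV[R]_n => \prod_(i < n) p i (x 0 i)).
Proof.
move=> mp; apply: measurable_prod => i _.
by apply: (measurableT_comp (mp i)); exact: measurable_rV_coord.
Qed.

Lemma integrable_rV_prod n (p : 'I_n -> R -> R) :
  (forall i, measurable_fun setT (p i)) -> (forall i a, 0 <= p i a) ->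
  (forall i, lebesgue_measure.-integrable setT (EFin \o p i)) ->
  lebesgue_rV.-integrable setT
    (EFin \o (fun x : 'rV[R]_n => \prod_(i < n) p i (x 0 i))).
Proof.
move=> mp p0 ip; apply/integrableP; split.
  by apply/measurable_EFinP; exact: measurable_rV_prod.
under eq_integral do rewrite /= ger0_norm ?prodr_ge0//.
rewrite ge0_integral_rV_prod//.
have fin i : (\int[lebesgue_measure]_a (p i a)%:E)%E \is a fin_num.
  exact: (integrable_fin_num _ (ip i)).
under eq_bigr do rewrite -(fineK (fin _)).
by rewrite prodEFin ltry.
Qed.

Definition rV_parab n (M : R) (x : 'rV[R]_n) : R := \prod_(i < n) parab M (x 0 i).

Definition rV_parab_hat n (M : R) (x : 'rV[R]_n) : R :=
  \prod_(i < n) parab_hat M (x 0 i).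

Lemma rV_parab_ge0 n M (x : 'rV[R]_n) : 0 <= rV_parab M x.
Proof. by rewrite prodr_ge0// => i _; exact: parab_ge0. Qed.

Lemma measurable_rV_parab n M : measurable_fun setT (@rV_parab n M).
Proof. exact: (measurable_rV_prod (fun=> measurable_parab M)). Qed.

Lemma integrable_rV_parab n M : 0 < M ->
  lebesgue_rV.-integrable setT (EFin \o @rV_parab n M).
Proof.
move=> M0; apply: (integrable_rV_prod (p := fun=> parab M)) => i.
- exact: measurable_parab.
- by move=> a; exact: parab_ge0.
- exact: integrable_parab.
Qed.

Lemma integrable_rV_parab_cos n M (z : 'rV[R]_n) c : 0 < M ->
  lebesgue_rV.-integrable setT
    (EFin \o (fun x => rV_parab M x * cos (dotp z x + c))).
Proof.
move=> M0; apply: (integrable_dominated _ (integrable_rV_parab n M0)) => [|x].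
  apply: measurable_funM; first exact: measurable_rV_parab.
  apply: measurable_funcos; apply: measurable_funD; last exact: measurable_cst.
  by apply: measurable_dotp => //; exact: measurable_cst.
by rewrite normrM ger0_norm ?rV_parab_ge0// ler_piMr ?rV_parab_ge0// normr_cos_le1.
Qed.

(** Induction on n: for fixed first coordinate a, the term z_0 a joins the phase c of the integral
    over the remaining coordinates, and the cosine of the new phase is then integrated in a by
    [parab_cos_hat]. *)
Lemma rV_parab_cos_hat n M (z : 'rV[R]_n) c : 0 < M ->
  \int[lebesgue_rV]_x (rV_parab M x * cos (dotp z x + c)) = rV_parab_hat M z * cos c.
Proof.
move=> M0; elim: n z c => [|n IHn] z c.
  by rewrite /Rintegral ge0_integral_rV0/= /rV_parab /rV_parab_hat /dotp !big_ord0 add0r.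
rewrite /Rintegral (integral_rV_cons (integrable_rV_parab_cos z c M0)).
pose z' : 'rV[R]_n := \row_i z 0 (lift ord0 i).
have zE : z = rV_cons (z 0 ord0, z').
  apply/rowP => i; case: (unliftP ord0 i) => [j ->|->].
    by rewrite rV_consS mxE.
  by rewrite rV_cons0.
transitivity (fine (\int[lebesgue_measure]_a
    (rV_parab_hat M z' * (parab M a * cos (z 0 ord0 * a + c)))%:E)).
  congr fine; apply: eq_integral => a _.
  transitivity (\int[lebesgue_rV]_v ((parab M a)%:E *
      (rV_parab M v * cos (dotp z' v + (z 0 ord0 * a + c)))%:E))%E.
    apply: eq_integral => v _; rewrite -EFinM /=; congr EFin.
    rewrite {1}/rV_parab big_ord_recl rV_cons0.
    under eq_bigr do rewrite rV_consS.
    by rewrite -mulrA; congr (_ * (_ * cos _)); rewrite {1}zE dotp_cons; ring.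
  rewrite integralZl//; last exact: integrable_rV_parab_cos.
  rewrite -EFin_Rintegral ?IHn; last exact: integrable_rV_parab_cos.
  by rewrite -EFinM mulrCA.
rewrite -/(Rintegral _ _ _) RintegralZl//; last first.
  apply: (integrable_dominated _ (integrable_parab M0)) => [|a].
    apply: measurable_funM; first exact: measurable_parab.
    by apply: measurable_funcos; apply: measurable_funD => //; apply: measurable_funM.
  by rewrite normrM ger0_norm ?parab_ge0// ler_piMr ?parab_ge0// normr_cos_le1.
rewrite -/(parab_cos M (z 0 ord0) c) parab_cos_hat// mulrA; congr (_ * _).
rewrite [in RHS]zE /rV_parab_hat big_ord_recl rV_cons0 mulrC; congr (_ * _).
by under [in RHS]eq_bigr do rewrite rV_consS.
Qed.

(** The factor 16 is the constant of [parab_hat_bound], so this kernel dominates [rV_parab_hat]. *)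
Definition rV_cauchy n (M : R) (x : 'rV[R]_n) : R :=
  \prod_(i < n) (16 * cauchy M (x 0 i)).

Lemma rV_cauchy_ge0 n M (x : 'rV[R]_n) : 0 < M -> 0 <= rV_cauchy M x.
Proof. by move=> M0; rewrite prodr_ge0// => i _; rewrite mulr_ge0// cauchy_ge0. Qed.

Lemma measurable_rV_cauchy n M : measurable_fun setT (@rV_cauchy n M).
Proof.
apply: (measurable_rV_prod (p := fun=> fun a => 16 * cauchy M a)) => i.
by apply: measurable_funM => //; exact: measurable_cauchy.
Qed.

Lemma rV_cauchy_le n M (x : 'rV[R]_n) : 0 < M -> rV_cauchy M x <= (16 * M) ^+ n.
Proof.
move=> M0; rewrite /rV_cauchy -[X in _ ^+ X]card_ord -prodr_const.
apply: ler_prod => i _; rewrite mulr_ge0 ?cauchy_ge0//= ler_wpM2l//.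
rewrite /cauchy ler_piMr ?(ltW M0)// invf_le1 ?cauchy_den_gt0//.
by rewrite lerDl sqr_ge0.
Qed.

Lemma rV_parab_hat_le n M (x : 'rV[R]_n) : 0 < M ->
  `|rV_parab_hat M x| <= rV_cauchy M x.
Proof.
move=> M0; rewrite normr_prod; apply: ler_prod => i _.
by rewrite normr_ge0 parab_hat_bound.
Qed.

(** The value depends neither on x nor on M: Schur's test will therefore hold uniformly in the size
    M of the cut-off. *)
Lemma integral_rV_cauchy_shift n M (x : 'rV[R]_n) : 0 < M ->
  (\int[lebesgue_rV]_y (rV_cauchy M (x - y))%:E = ((16 * pi) ^+ n)%:E)%E.
Proof.
move=> M0.
pose p i a := 16 * cauchy M (x 0 i - a).
transitivity (\int[lebesgue_rV]_(y in [set: 'rV[R]_n]) (\prod_(i < n) p i (y 0 i))%:E)%E.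
  by apply: eq_integral => y _; congr EFin; apply: eq_bigr => i _; rewrite !mxE.
rewrite ge0_integral_rV_prod.
- rewrite -[in RHS](card_ord n) -prodr_const -prodEFin; apply: eq_bigr => i _.
  under eq_integral do rewrite /p EFinM.
  rewrite ge0_integralZl//.
  + by rewrite integral_cauchy_shift// -EFinM.
  + apply/measurable_EFinP; apply: (measurableT_comp (@measurable_cauchy _ M)).
    by apply: measurable_funB.
  + by move=> a _; rewrite lee_fin cauchy_ge0.
- move=> i; apply: measurable_funM => //.
  by apply: (measurableT_comp (@measurable_cauchy _ M)); apply: measurable_funB.
- by move=> i a; rewrite mulr_ge0// cauchy_ge0.
Qed.

End rV_weight.

(** * The Plancherel inequality *)

Lemma fatou_le d (T : measurableType d) (R : realType)
    (mu : {measure set T -> \bar R}) (f : (T -> \bar R)^nat) (g : T -> \bar R)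
    (B : \bar R) :
  (forall k, measurable_fun setT (f k)) -> (forall k x, 0 <= f k x)%E ->
  (forall x, f k x @[k --> \oo] --> g x) ->
  (forall k, \int[mu]_x f k x <= B)%E -> (\int[mu]_x g x <= B)%E.
Proof.
move=> mf f0 fg fB.
have -> : (\int[mu]_x g x = \int[mu]_x limn_einf (f^~ x))%E.
  by apply: eq_integral => x _; rewrite (cvg_limn_einf_sup (fg x)).1.
apply: (le_trans (fatou mu measurableT mf (fun k x _ => f0 k x))).
rewrite limn_einf_lim; apply: lime_le; first exact: is_cvg_einfs.
apply: nearW => k; apply: le_trans (fB k).
by apply: ereal_inf_lbound; exists k => /=.
Qed.

Lemma cvg_rV_parab (R : realType) n (x : 'rV[R]_n) :
  rV_parab k.+1%:R x @[k --> \oo] --> (1 : R).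
Proof.
have h (a : R) : parab k.+1%:R a @[k --> \oo] --> (1 : R).
  (* Squeeze: the cut-off lies between its unclipped parabola and 1. *)
  apply: (@squeeze_cvgr _ _ _ _ (fun k => 1 - (a * harmonic k) ^+ 2) (cst 1)).
  - by apply: nearW => k; rewrite parab_le1 andbT le_max lexx orbT.
  - rewrite -[X in _ --> X]subr0; apply: cvgB; first exact: cvg_cst.
    have ah : a * harmonic k @[k --> \oo] --> 0.
      rewrite -[X in _ --> X](mulr0 a); apply: cvgM; [exact: cvg_cst|exact: cvg_harmonic].
    by rewrite -[X in _ --> X](mulr0 0); exact: (cvgM ah ah).
  - exact: cvg_cst.
rewrite /rV_parab; elim: n x => [|n IHn] x.
  by under eq_fun do rewrite big_ord0; exact: cvg_cst.
rewrite [X in X @ _ --> _](_ : _ = fun k => parab k.+1%:R (x 0 ord0) *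
    \prod_(i < n) parab k.+1%:R ((\row_i x 0 (lift ord0 i)) 0 i)).
  rewrite -[X in _ --> X]mulr1; apply: cvgM; [exact: h|exact: IHn].
apply/funext => k; rewrite [LHS]big_ord_recl; congr (_ * _).
by apply: eq_bigr => i _; rewrite mxE.
Qed.

Section plancherel.
Variables (R : realType) (n : nat).
Local Notation leb := (@lebesgue_rV R n).
Implicit Types (u : 'rV[R]_n -> R) (x xi eta : 'rV[R]_n) (M : R).

(** With [sin_transform], the real and imaginary parts of the integral of e^(i xi.x) u(xi); for real
    u the sum of their squares is its squared modulus. *)
Definition cos_transform u x := \int[leb]_xi (cos (dotp xi x) * u xi).
Definition sin_transform u x := \int[leb]_xi (sin (dotp xi x) * u xi).

Lemma integrable_cos_mul u (theta : 'rV[R]_n -> R) : measurable_fun setT theta ->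
  leb.-integrable setT (EFin \o u) ->
  leb.-integrable setT (EFin \o (fun xi => cos (theta xi) * u xi)).
Proof.
move=> mt; apply: integrable_bounded_mul => [|x]; last exact: normr_cos_le1.
exact: measurable_funcos.
Qed.

Lemma integrable_sin_mul u (theta : 'rV[R]_n -> R) : measurable_fun setT theta ->
  leb.-integrable setT (EFin \o u) ->
  leb.-integrable setT (EFin \o (fun xi => sin (theta xi) * u xi)).
Proof.
move=> mt; apply: integrable_bounded_mul => [|x]; last exact: normr_sin_le1.
exact: measurable_funsin.
Qed.

Lemma measurable_dotpl x : measurable_fun setT (fun xi => dotp xi x).
Proof. by apply: measurable_dotp => //; exact: measurable_cst. Qed.

Variable u : 'rV[R]_n -> R.
Hypothesis iu : leb.-integrable setT (EFin \o u).

Let mu : measurable_fun setT u.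
Proof. by have /integrableP[/measurable_EFinP] := iu. Qed.

Lemma measurable_cos_transform : measurable_fun setT (cos_transform u).
Proof.
apply: (@measurable_Rintegral_param _ _ _ _ _ leb (fun x xi => cos (dotp xi x) * u xi)).
apply: measurable_funM; last exact: measurableT_comp.
by apply: measurable_funcos; exact: measurable_dotp.
Qed.

Lemma measurable_sin_transform : measurable_fun setT (sin_transform u).
Proof.
apply: (@measurable_Rintegral_param _ _ _ _ _ leb (fun x xi => sin (dotp xi x) * u xi)).
apply: measurable_funM; last exact: measurableT_comp.
by apply: measurable_funsin; exact: measurable_dotp.
Qed.

(** The inner integral obtained when the squared modulus of the transform is written as a double
    integral in (xi, eta). *)
Let J xi x := \int[leb]_eta (cos (dotp (xi - eta) x) * u eta).

Let JE xi x : J xi x =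
  cos (dotp xi x) * cos_transform u x + sin (dotp xi x) * sin_transform u x.
Proof.
have ic := integrable_cos_mul (measurable_dotpl x) iu.
have isn := integrable_sin_mul (measurable_dotpl x) iu.
rewrite /cos_transform /sin_transform -!RintegralZl// -RintegralD//; first last.
- exact: (integrableZl _ (sin (dotp xi x)) isn).
- exact: (integrableZl _ (cos (dotp xi x)) ic).
by apply: eq_Rintegral => eta _; rewrite dotpBl cosB; ring.
Qed.

Let J_le xi x : `|J xi x| <= \int[leb]_eta `|u eta|.
Proof.
apply: normr_Rintegral_le.
- apply: measurable_funM => //; apply: measurable_funcos.
  apply: measurable_dotp; last exact: measurable_cst.
  apply: measurable_to_rV => i.
  rewrite (_ : _ \o _ = (fun eta => xi 0 i - @rV_coord R n i eta)).
    by apply: measurable_funB => //; exact: measurable_rV_coord.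
  by apply/funext => eta; rewrite /= /rV_coord !mxE.
- exact: (integrable_abse iu).
- by move=> eta; rewrite normrM ler_piMl// normr_cos_le1.
Qed.

Let sqr_sumE x : \int[leb]_xi (J xi x * u xi) =
  cos_transform u x ^+ 2 + sin_transform u x ^+ 2.
Proof.
have ic := integrable_cos_mul (measurable_dotpl x) iu.
have isn := integrable_sin_mul (measurable_dotpl x) iu.
rewrite !expr2 {1}/cos_transform {1}/sin_transform -!RintegralZr// -RintegralD//; first last.
- exact: (integrableZr _ _ isn).
- exact: (integrableZr _ _ ic).
by apply: eq_Rintegral => xi _; rewrite JE; ring.
Qed.

Let mJ : measurable_fun setT (fun z : 'rV[R]_n * 'rV[R]_n => J z.1 z.2).
Proof.
rewrite (_ : (fun z => _) = (fun z : 'rV[R]_n * 'rV[R]_n =>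
  cos (dotp z.1 z.2) * cos_transform u z.2 + sin (dotp z.1 z.2) * sin_transform u z.2)).
  have md : measurable_fun setT (fun z : 'rV[R]_n * 'rV[R]_n => dotp z.1 z.2).
    exact: measurable_dotp.
  apply: measurable_funD; apply: measurable_funM.
  - exact: measurable_funcos.
  - by apply: measurableT_comp => //; exact: measurable_cos_transform.
  - exact: measurable_funsin.
  - by apply: measurableT_comp => //; exact: measurable_sin_transform.
by apply/funext => z; rewrite JE.
Qed.

(** With the weight inserted, x can be integrated first; K is then the convolution of u with the
    transform of the weight. *)
Let K M xi := \int[leb]_x (rV_parab M x * J xi x).

Let weighted M : 0 < M ->
  \int[leb]_x (rV_parab M x * (cos_transform u x ^+ 2 + sin_transform u x ^+ 2)) =
  \int[leb]_xi (K M xi * u xi).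
Proof.
move=> M0; set L := \int[leb]_eta `|u eta|.
have iparab := integrable_rV_parab n M0.
transitivity (\int[leb]_x \int[leb]_xi (rV_parab M x * (J xi x * u xi))).
  apply: eq_Rintegral => x _; rewrite -sqr_sumE RintegralZl//.
  apply: integrable_bounded_mul (J_le^~ x) iu.
  exact: (measurableT_comp mJ (pair2_measurable x)).
rewrite (@Rintegral_exchange _ _ _ _ _ leb leb _
  (fun x => rV_parab M x * L) (fun xi => `|u xi|)).
- apply: eq_Rintegral => xi _; rewrite /K -RintegralZr//.
    by apply: eq_Rintegral => x _; rewrite mulrA.
  apply: (@integrable_dominated _ _ _ leb _ (fun x => rV_parab M x * L)).
  + apply: measurable_funM; first exact: measurable_rV_parab.
    exact: (measurableT_comp mJ (pair1_measurable xi)).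
  + exact: (integrableZr _ L iparab).
  + move=> x; rewrite normrM ger0_norm ?rV_parab_ge0//.
    by rewrite ler_wpM2l ?rV_parab_ge0.
- apply: measurable_funM.
    by apply: measurableT_comp => //; exact: measurable_rV_parab.
  apply: measurable_funM; last exact: measurableT_comp.
  exact: (measurableT_comp mJ (@measurable_swap _ _ _ _)).
- exact: (integrableZr _ L iparab).
- exact: (integrable_abse iu).
- move=> x xi; rewrite !normrM (ger0_norm (rV_parab_ge0 _ _)) -mulrA.
  by rewrite ler_wpM2l ?rV_parab_ge0// ler_wpM2r.
Qed.

(** Exchanging the x and eta integrals exhibits K as the convolution of [rV_parab_hat] with u, and
    [rV_cauchy] dominates that kernel. *)
Let K_le M xi : 0 < M ->
  `|K M xi| <= \int[leb]_eta (rV_cauchy M (xi - eta) * `|u eta|).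
Proof.
move=> M0; have iparab := integrable_rV_parab n M0.
have msub : measurable_fun setT (fun eta => xi - eta).
  apply: measurable_to_rV => i.
  rewrite (_ : _ \o _ = (fun eta => xi 0 i - @rV_coord R n i eta)).
    by apply: measurable_funB => //; exact: measurable_rV_coord.
  by apply/funext => eta; rewrite /= /rV_coord !mxE.
have mg : measurable_fun setT (fun z : 'rV[R]_n * 'rV[R]_n =>
    rV_parab M z.1 * (cos (dotp (xi - z.2) z.1) * u z.2)).
  apply: measurable_funM.
    by apply: measurableT_comp => //; exact: measurable_rV_parab.
  apply: measurable_funM; last exact: measurableT_comp.
  apply: measurable_funcos; apply: measurable_dotp => //.
  exact: (measurableT_comp msub measurable_snd).
have KE : K M xi = \int[leb]_eta (rV_parab_hat M (xi - eta) * u eta).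
  transitivity (\int[leb]_x \int[leb]_eta
      (rV_parab M x * (cos (dotp (xi - eta) x) * u eta))).
    apply: eq_Rintegral => x _; rewrite RintegralZl//.
    apply: integrable_cos_mul iu; apply: measurable_dotp => //; exact: measurable_cst.
  rewrite (@Rintegral_exchange _ _ _ _ _ leb leb _ (@rV_parab R n M) (fun eta => `|u eta|))//.
  - apply: eq_Rintegral => eta _.
    under eq_Rintegral do rewrite mulrA -[X in cos X]addr0.
    rewrite RintegralZr//; last exact: integrable_rV_parab_cos.
    by rewrite rV_parab_cos_hat// cos0 mulr1.
  - exact: (integrable_abse iu).
  - move=> x eta; rewrite !normrM (ger0_norm (rV_parab_ge0 _ _)).
    by rewrite ler_wpM2l ?rV_parab_ge0// ler_piMl// normr_cos_le1.
have mhat : measurable_fun setT (fun eta => rV_parab_hat M (xi - eta)).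
  have -> : (fun eta => rV_parab_hat M (xi - eta)) =
      (fun eta => \int[leb]_x (rV_parab M x * cos (dotp (xi - eta) x + 0))).
    by apply/funext => eta; rewrite rV_parab_cos_hat// cos0 mulr1.
  apply: (@measurable_Rintegral_param _ _ _ _ _ leb
    (fun eta x => rV_parab M x * cos (dotp (xi - eta) x + 0))).
  apply: measurable_funM.
    by apply: measurableT_comp => //; exact: measurable_rV_parab.
  apply: measurable_funcos; apply: measurable_funD => //; apply: measurable_dotp => //.
  exact: (measurableT_comp msub measurable_fst).
rewrite KE; apply: normr_Rintegral_le.
- exact: measurable_funM.
- apply: (@integrable_bounded_mul _ _ _ leb (fun eta => rV_cauchy M (xi - eta))
    (fun eta => `|u eta|) ((16 * M) ^+ n)).
  + by apply: measurableT_comp => //; exact: measurable_rV_cauchy.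
  + by move=> eta; rewrite ger0_norm ?rV_cauchy_ge0// rV_cauchy_le.
  + exact: (integrable_abse iu).
- by move=> eta; rewrite normrM ler_wpM2r// rV_parab_hat_le.
Qed.

Let D := (\int[leb]_xi (u xi ^+ 2)%:E)%E.

Let mcauchy M : measurable_fun setT
  (fun z : 'rV[R]_n * 'rV[R]_n => rV_cauchy M (z.1 - z.2)).
Proof.
apply: measurableT_comp; first exact: measurable_rV_cauchy.
apply: measurable_to_rV => i.
rewrite (_ : _ \o _ = (fun z => @rV_coord R n i z.1 - @rV_coord R n i z.2)).
  by apply: measurable_funB; apply: measurableT_comp => //; exact: measurable_rV_coord.
by apply/funext => z; rewrite /= /rV_coord !mxE.
Qed.

Let cauchyC M xi eta : rV_cauchy M (xi - eta) = rV_cauchy M (eta - xi).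
Proof.
by apply: eq_bigr => i _; rewrite !mxE /cauchy -(opprB (eta 0 i)) mulrN sqrrN.
Qed.

(* AM-GM: |u xi u eta| <= (u xi^2 + u eta^2) / 2, and the kernel has the same
   integral in either variable (Schur's test). *)
Let schur M : 0 < M ->
  (\int[leb]_xi \int[leb]_eta (rV_cauchy M (xi - eta) * `|u eta| * `|u xi|)%:E
   <= ((16 * pi) ^+ n)%:E * D)%E.
Proof.
move=> M0; set kap := (16 * pi) ^+ n.
have c0 := fun x => @rV_cauchy_ge0 R n M x M0.
have kap0 : 0 <= kap by rewrite exprn_ge0// mulr_ge0// pi_ge0.
pose h := fun z : 'rV[R]_n * 'rV[R]_n => (2^-1 * u z.1 ^+ 2 * rV_cauchy M (z.1 - z.2))%:E.
have mh : measurable_fun setT h.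
  apply/measurable_EFinP; apply: measurable_funM => //.
  apply: measurable_funM => //; apply: measurable_funX; exact: measurableT_comp.
have h0 z : (0 <= h z)%E by rewrite lee_fin mulr_ge0 ?c0// mulr_ge0// sqr_ge0.
pose hs z := h (z.2, z.1).
have mhs : measurable_fun setT hs.
  exact: (measurableT_comp mh (@measurable_swap _ _ _ _)).
(* Here h carries the half with (u xi)^2 and its swap hs the half with (u eta)^2; by Tonelli both
   integrate to kap D / 2. *)
have hint : (\int[leb]_xi \int[leb]_eta h (xi, eta) = (2^-1 * kap)%:E * D)%E.
  rewrite /D -ge0_integralZl//; first last.
  - by rewrite lee_fin mulr_ge0// invr_ge0.
  - by move=> xi _; rewrite lee_fin sqr_ge0.
  - by apply/measurable_EFinP; exact: measurable_funX.
  apply: eq_integral => xi _; rewrite /h/=.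
  under eq_integral do rewrite EFinM.
  rewrite ge0_integralZl//; first last.
  - by rewrite lee_fin mulr_ge0 ?sqr_ge0// invr_ge0.
  - by move=> eta _; rewrite lee_fin.
  - by apply/measurable_EFinP; exact: (measurableT_comp (mcauchy M) (pair1_measurable xi)).
  by rewrite integral_rV_cauchy_shift// -!EFinM; congr EFin; rewrite -/kap; ring.
apply: (@le_trans _ _ (\int[leb]_xi (\int[leb]_eta h (xi, eta) +
    \int[leb]_eta hs (xi, eta)))%E).
  apply: ge0_le_integral => //.
  - by move=> xi _; apply: integral_ge0 => eta _; rewrite lee_fin !mulr_ge0.
  - apply: (measurable_fun_fubini_tonelli_F (fun z : 'rV[R]_n * 'rV[R]_n =>
      (rV_cauchy M (z.1 - z.2) * `|u z.2| * `|u z.1|)%:E)).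
      apply/measurable_EFinP; apply: measurable_funM; first apply: measurable_funM => //.
        by apply: measurableT_comp => //; exact: measurableT_comp.
      by apply: measurableT_comp => //; exact: measurableT_comp.
    by move=> z; rewrite lee_fin !mulr_ge0.
  - apply: emeasurable_funD; first exact: (measurable_fun_fubini_tonelli_F h).
    by apply: (measurable_fun_fubini_tonelli_F hs) => // z; exact: h0.
  move=> xi _; rewrite -ge0_integralD//; first last.
  - exact: (measurableT_comp mhs (pair1_measurable xi)).
  - by move=> eta _; exact: h0.
  - exact: (measurableT_comp mh (pair1_measurable xi)).
  apply: ge0_le_integral => //.
  - by move=> eta _; rewrite lee_fin !mulr_ge0.
  - apply/measurable_EFinP; apply: measurable_funM => //; apply: measurable_funM.
      exact: (measurableT_comp (mcauchy M) (pair1_measurable xi)).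
    exact: measurableT_comp.
  - apply: emeasurable_funD; first exact: (measurableT_comp mh (pair1_measurable xi)).
    exact: (measurableT_comp mhs (pair1_measurable xi)).
  move=> eta _; rewrite /hs /h/= -EFinD lee_fin (cauchyC M eta xi).
  rewrite -(real_normK (num_real (u xi))) -(real_normK (num_real (u eta))).
  move: (c0 (xi - eta)); move: (rV_cauchy _ _) `|u xi| `|u eta| => b s t b0.
  rewrite -subr_ge0 (_ : _ - _ = 2^-1 * b * (s - t) ^+ 2); last by field.
  by rewrite mulr_ge0 ?sqr_ge0// mulr_ge0.
rewrite ge0_integralD//; first last.
- by apply: (measurable_fun_fubini_tonelli_F hs) => // z; exact: h0.
- by move=> xi _; apply: integral_ge0 => eta _; exact: h0.
- exact: (measurable_fun_fubini_tonelli_F h).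
- by move=> xi _; apply: integral_ge0 => eta _; exact: h0.
rewrite [X in (_ + X)%E](fubini_tonelli hs)//; last by move=> z; exact: h0.
rewrite /hs/= hint -ge0_muleDl ?lee_fin ?mulr_ge0 ?invr_ge0//.
by rewrite -EFinD (_ : _ + _ = kap)//; field.
Qed.

(** The left side is the integral of K u by [weighted]; [K_le] bounds it by the double integral in
    [schur]. Most of the proof checks the integrability that lets real and extended integrals be
    identified. *)
Let weighted_le M : 0 < M ->
  (\int[leb]_x (rV_parab M x * (cos_transform u x ^+ 2 + sin_transform u x ^+ 2))%:E
   <= ((16 * pi) ^+ n)%:E * D)%E.
Proof.
move=> M0; have c0 := fun x => @rV_cauchy_ge0 R n M x M0.
pose L := \int[leb]_eta `|u eta|.
have mC := measurable_cos_transform; have mS := measurable_sin_transform.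
rewrite -EFin_Rintegral; last first.
  have CL x : `|cos_transform u x ^+ 2 + sin_transform u x ^+ 2| <= L ^+ 2 + L ^+ 2.
    have b (f : 'rV[R]_n -> R) : measurable_fun setT f -> (forall xi, `|f xi| <= 1) ->
        `|\int[leb]_xi (f xi * u xi)| ^+ 2 <= L ^+ 2.
      move=> mf f1; rewrite ler_sqr ?nnegrE//; last exact: Rintegral_ge0.
      apply: normr_Rintegral_le; [exact: measurable_funM|exact: (integrable_abse iu)|].
      by move=> xi; rewrite normrM ler_piMl.
    rewrite ger0_norm ?addr_ge0 ?sqr_ge0//.
    rewrite -(real_normK (num_real (cos_transform u x))).
    rewrite -(real_normK (num_real (sin_transform u x))); apply: lerD; apply: b.
    - by apply: measurable_funcos; exact: measurable_dotpl.
    - by move=> xi; exact: normr_cos_le1.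
    - by apply: measurable_funsin; exact: measurable_dotpl.
    - by move=> xi; exact: normr_sin_le1.
  rewrite (_ : EFin \o _ = EFin \o (fun x =>
    (cos_transform u x ^+ 2 + sin_transform u x ^+ 2) * rV_parab M x)); last first.
    by apply/funext => x /=; rewrite mulrC.
  apply: (@integrable_bounded_mul _ _ _ leb
    (fun x => cos_transform u x ^+ 2 + sin_transform u x ^+ 2) (rV_parab M) _ _ CL).
    by apply: measurable_funD; exact: measurable_funX.
  exact: integrable_rV_parab.
rewrite weighted//; apply: le_trans (schur M0).
have mK : measurable_fun setT (K M).
  apply: (@measurable_Rintegral_param _ _ _ _ _ leb (fun xi x => rV_parab M x * J xi x)).
  apply: measurable_funM => //.
  by apply: measurableT_comp => //; exact: measurable_rV_parab.
have iB xi : leb.-integrable setT (EFin \o (fun eta => rV_cauchy M (xi - eta) * `|u eta|)).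
  apply: (@integrable_bounded_mul _ _ _ leb (fun eta => rV_cauchy M (xi - eta))
    (fun eta => `|u eta|) ((16 * M) ^+ n)).
  + exact: (measurableT_comp (mcauchy M) (pair1_measurable xi)).
  + by move=> eta; rewrite ger0_norm ?rV_cauchy_ge0// rV_cauchy_le.
  + exact: (integrable_abse iu).
have K_bounded xi : `|K M xi| <= (16 * M) ^+ n * L.
  apply: (le_trans (K_le xi M0)); rewrite -RintegralZl//; last exact: (integrable_abse iu).
  apply: le_Rintegral => //; first exact: (integrableZl _ _ (integrable_abse iu)).
  by move=> eta _; rewrite ler_wpM2r// rV_cauchy_le.
have iKu := integrable_bounded_mul mK K_bounded iu.
apply: (@le_trans _ _ (\int[leb]_xi `|(K M xi * u xi)%:E|)%E).
  rewrite EFin_Rintegral// (le_trans (lee_abs _))//.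
  by apply: le_abse_integral => //; apply/measurable_EFinP; exact: measurable_funM.
apply: ge0_le_integral => //.
- by apply/measurable_EFinP; apply: measurableT_comp => //; exact: measurable_funM.
- apply: (measurable_fun_fubini_tonelli_F (fun z : 'rV[R]_n * 'rV[R]_n =>
    (rV_cauchy M (z.1 - z.2) * `|u z.2| * `|u z.1|)%:E)).
    apply/measurable_EFinP; apply: measurable_funM; first apply: measurable_funM => //.
      by apply: measurableT_comp => //; exact: measurableT_comp.
    by apply: measurableT_comp => //; exact: measurableT_comp.
  by move=> z; rewrite lee_fin !mulr_ge0.
move=> xi _; rewrite -(@EFin_Rintegral _ _ _ leb); last exact: (integrableZr _ _ (iB xi)).
by rewrite RintegralZr// lee_fin normrM ler_wpM2r// K_le.
Qed.

(** The weighted bound is uniform in M and the weights tend to 1 pointwise, so Fatou's lemma removes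
    them. An upper bound with a non-sharp constant is enough for a maximal estimate. *)
Lemma plancherel_le :
  (\int[leb]_x (cos_transform u x ^+ 2 + sin_transform u x ^+ 2)%:E
   <= ((16 * pi) ^+ n)%:E * \int[leb]_xi (u xi ^+ 2)%:E)%E.
Proof.
have mC := measurable_cos_transform; have mS := measurable_sin_transform.
apply: (@fatou_le _ _ _ leb (fun k x => (rV_parab k.+1%:R x *
   (cos_transform u x ^+ 2 + sin_transform u x ^+ 2))%:E)).
- move=> k; apply/measurable_EFinP; apply: measurable_funM; first exact: measurable_rV_parab.
  by apply: measurable_funD; exact: measurable_funX.
- by move=> k x; rewrite lee_fin mulr_ge0 ?rV_parab_ge0// addr_ge0// sqr_ge0.
- move=> x; apply: cvg_EFin; first by apply: nearW.
  set T := _ + _; rewrite [X in X @ _ --> _](_ : _ = fun k => rV_parab k.+1%:R x * T)//.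
  rewrite -[X in _ --> X]mul1r; apply: cvgM; [exact: cvg_rV_parab|exact: cvg_cst].
- by move=> k; exact: weighted_le.
Qed.

End plancherel.

(** * Schwartz functions: decay, integration by parts, and decay of the Fourier transform *)

Lemma cvg_Rintegral_dominated d (T : measurableType d) (R : realType)
    (mu : {measure set T -> \bar R}) (f_ : nat -> T -> R) (f g : T -> R) :
  (forall k, measurable_fun setT (f_ k)) -> measurable_fun setT f ->
  (forall x, f_ k x @[k --> \oo] --> f x) ->
  mu.-integrable setT (EFin \o g) -> (forall k x, `|f_ k x| <= g x) ->
  \int[mu]_x f_ k x @[k --> \oo] --> \int[mu]_x f x.
Proof.
move=> mf_ mf ff gi fg.
have fi k : mu.-integrable setT (EFin \o f_ k) := integrable_dominated (mf_ k) gi (fg k).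
have [] := @dominated_convergence _ _ _ mu setT measurableT
  (fun k => EFin \o f_ k) (EFin \o f) (EFin \o g).
- by move=> k; exact/measurable_EFinP.
- exact/measurable_EFinP.
- by apply: aeW => x _; apply: cvg_EFin; [exact: nearW|exact: ff].
- exact: gi.
- by apply: aeW => x k _ /=; rewrite lee_fin.
move=> ifi _; rewrite -EFin_Rintegral// => h.
rewrite (_ : (fun k => _) = fine \o (fun k => \int[mu]_x (EFin \o f_ k) x)%E)//.
exact: fine_cvg.
Qed.

Lemma Rintegral_rV_shift (R : realType) n (h : 'rV[R]_n) (f : 'rV[R]_n -> R) :
  measurable_fun setT f ->
  \int[lebesgue_rV]_x f (x + h) = \int[lebesgue_rV]_x f x.
Proof.
move=> mf; have mfE : measurable_fun setT (EFin \o f) by exact/measurable_EFinP.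
rewrite /Rintegral [in LHS]integralE [in RHS]integralE; congr (fine (_ - _)).
- rewrite -[RHS](ge0_integral_rV_shift h)//; last exact: measurable_funepos.
  by apply: eq_integral => x _; rewrite !funeposE.
- rewrite -[RHS](ge0_integral_rV_shift h)//; last exact: measurable_funeneg.
  by apply: eq_integral => x _; rewrite !funenegE.
Qed.

(** Directional derivatives are taken along the steps 1/(k+1), because dominated convergence is used
    for sequences. *)
Lemma cvg_derive_harmonic (R : realType) (V : normedModType R) (f : V -> R) (x v : V) :
  derivable f x v ->
  (harmonic k)^-1 * (f (harmonic k *: v + x) - f x) @[k --> \oo] --> 'D_v f x.
Proof.
move=> df; apply: (cvg_comp (@harmonic R)
  (fun h : R => h^-1 *: ((f \o shift x) (h *: v) - f x)) _ df).
move=> A /= [e/= e0 eA].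
have /cvgrPdist_lt /(_ e e0)[N _ NP] := @cvg_harmonic R.
exists N => // k /NP h; apply: eA => //=.
Qed.

Section schwartz_decay.
Variables (R : realType) (n : nat).
Implicit Types (u : 'rV[R]_n -> R) (x xi : 'rV[R]_n) (j : 'I_n).

(** An integrable function whose reciprocal is a polynomial, so that bounds on monomials times u
    convert into multiples of it. *)
Definition rV_decay x : R := \prod_(i < n) cauchy 1 (x 0 i).

Lemma rV_decay_ge0 x : 0 <= rV_decay x.
Proof. by rewrite prodr_ge0// => i _; exact: cauchy_ge0. Qed.

Lemma measurable_rV_decay : measurable_fun setT rV_decay.
Proof. exact: (measurable_rV_prod (fun=> measurable_cauchy 1)). Qed.

Lemma integrable_rV_decay : lebesgue_rV.-integrable setT (EFin \o rV_decay).
Proof.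
apply: (integrable_rV_prod (p := fun=> cauchy 1)) => i.
- exact: measurable_cauchy.
- by move=> a; exact: cauchy_ge0.
- apply/integrableP; split; first by apply/measurable_EFinP; exact: measurable_cauchy.
  under eq_integral do rewrite /= ger0_norm ?cauchy_ge0//.
  by rewrite integral_cauchy// ltry.
Qed.

Lemma rV_decayE x : rV_decay x * \prod_(i < n) (1 + x 0 i ^+ 2) = 1.
Proof.
rewrite -big_split/= big1// => i _; rewrite /cauchy mul1r mul1r mulVf//.
by rewrite gt_eqF// ltr_pwDl// sqr_ge0.
Qed.

(** Only the factor of index j changes, and 1 + a^2 <= 3 (1 + (t + a)^2) when |t| <= 1. *)
Lemma rV_decay_shift x j (t : R) : `|t| <= 1 ->
  rV_decay (t *: delta_mx 0 j + x) <= 3 * rV_decay x.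
Proof.
move=> t1; rewrite /rV_decay (bigD1 j)//= [in leRHS](bigD1 j)//= mulrA.
have -> : \prod_(i < n | i != j) cauchy 1 ((t *: delta_mx 0 j + x) 0 i) =
    \prod_(i < n | i != j) cauchy 1 (x 0 i).
  by apply: eq_bigr => i ij; rewrite !mxE eqxx (negbTE ij) mulr0 add0r.
rewrite ler_wpM2r//; first by rewrite prodr_ge0// => i _; exact: cauchy_ge0.
rewrite !mxE !eqxx mulr1 /cauchy !mul1r.
have t2 : t ^+ 2 <= 1 by rewrite -real_normK ?num_real// expr_le1.
move: (x 0 j) => a; have d1 : 0 < 1 + (t + a) ^+ 2 by rewrite ltr_pwDl// sqr_ge0.
have d2 : 0 < 1 + a ^+ 2 by rewrite ltr_pwDl// sqr_ge0.
rewrite ler_pdivlMr// mulrC ler_pdivrMr//.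
have := sqr_ge0 (2 * t + a); nra.
Qed.

Definition real_schwartz u := smooth u /\ rapidly_decreasing u.

Lemma partials_cat s1 s2 u : partials (s1 ++ s2) u = partials s1 (partials s2 u).
Proof. by elim: s1 => //= i s1 ->. Qed.

Lemma real_schwartz_partials s u : real_schwartz u -> real_schwartz (partials s u).
Proof.
move=> [su ru]; split=> [t|k t]; rewrite -partials_cat; [exact: su|exact: ru].
Qed.

Lemma real_schwartz_continuous u : real_schwartz u -> continuous u.
Proof. by move=> [/(_ [::])[]]. Qed.

Lemma real_schwartz_measurable u : real_schwartz u -> measurable_fun setT u.
Proof. by move=> /real_schwartz_continuous; exact: continuous_measurable_rV. Qed.

(** Expand the product of the 1 + x_i^2 into monomials, one for each subset of the coordinates;
    rapid decrease bounds each of them times u, and C is the sum of these bounds. *)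
Lemma real_schwartz_decay u : real_schwartz u ->
  exists2 C, 0 <= C & forall x, `|u x| <= C * rV_decay x.
Proof.
move=> [_ ru].
have h (f : {ffun 'I_n -> bool}) : exists M, forall x,
    `|(\prod_(i < n) x 0 i ^+ (f i).*2) * u x| <= M.
  by have [M hM] := ru (fun i => (f i : nat).*2) [::]; exists M.
have [M hM] := choice h.
exists (\sum_(f : {ffun 'I_n -> bool}) M f).
  by apply: sumr_ge0 => f _; apply: le_trans (hM f 0).
move=> x.
rewrite -[`|u x|]mul1r -(rV_decayE x) -mulrA mulrC ler_wpM2r ?rV_decay_ge0//.
have -> : \prod_(i < n) (1 + x 0 i ^+ 2) =
    \prod_(i < n) \sum_(b : bool) (x 0 i ^+ (b : nat).*2).
  by apply: eq_bigr => i _; rewrite big_bool/= expr0 addrC.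
rewrite bigA_distr_bigA/= mulr_suml; apply: ler_sum => f _.
apply: le_trans (hM f x); rewrite normrM ler_wpM2r//.
exact: ler_norm.
Qed.

Lemma real_schwartz_integrable u : real_schwartz u ->
  lebesgue_rV.-integrable setT (EFin \o u).
Proof.
move=> su; have [C _ uC] := real_schwartz_decay su.
apply: integrable_dominated uC; first exact: real_schwartz_measurable.
exact: (integrableZl _ C integrable_rV_decay).
Qed.

Lemma is_derive_line u x j (t : R) : real_schwartz u ->
  is_derive t 1 (fun r : R => u (r *: delta_mx 0 j + x))
    (partials [:: j] u (t *: delta_mx 0 j + x)).
Proof.
move=> [/(_ [::])[_ /(_ (t *: delta_mx 0 j + x) j)/= du] _].
have e : (fun h : R => h^-1 *: (((fun r : R => u (r *: delta_mx 0 j + x)) \o shift t) (h *: 1) -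
     u (t *: delta_mx 0 j + x))) =
   (fun h : R => h^-1 *: ((u \o shift (t *: delta_mx 0 j + x)) (h *: delta_mx 0 j) -
     u (t *: delta_mx 0 j + x))).
  apply/funext => h /=; congr (_ *: (u _ - _)).
  by rewrite /GRing.scale/= mulr1 -/(GRing.scale _ _) scalerDl addrA.
by split; rewrite /derivable /derive e.
Qed.

(** By the mean value theorem the quotient is a partial derivative at distance at most 1 from x, and
    [rV_decay_shift] moves its bound back to x. This is the dominating function for differentiation
    under the integral. *)
Lemma difference_quotient_le u x j C (h : R) : real_schwartz u ->
  (forall y, `|partials [:: j] u y| <= C * rV_decay y) -> 0 <= C -> 0 < h <= 1 ->
  `|h^-1 * (u (h *: delta_mx 0 j + x) - u x)| <= 3 * C * rV_decay x.
Proof.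
move=> su hC C0 /andP[h0 h1].
have := @MVT R (fun r : R => u (r *: delta_mx 0 j + x))
  (fun t => partials [:: j] u (t *: delta_mx 0 j + x)) 0 h h0.
case.
- by move=> t _; exact: is_derive_line.
- apply: derivable_within_continuous => t _.
  by have [] := is_derive_line x j t su.
move=> t; rewrite in_itv/= => /andP[t0 th]; rewrite scale0r add0r subr0 => ->.
rewrite mulrCA mulVf ?gt_eqF// mulr1 (le_trans (hC _))//.
rewrite (mulrC 3) -mulrA ler_wpM2l// rV_decay_shift//.
by rewrite gtr0_norm// (le_trans (ltW th)).
Qed.

(** Phase 0 gives the cosine transform and phase -pi/2 the sine transform; integration by parts
    stays in this family, shifting c by a quarter period. *)
Definition osc u xi (c : R) : R := \int[lebesgue_rV]_x (cos (dotp xi x + c) * u x).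

End schwartz_decay.

Section integration_by_parts_rV.
Variables (R : realType) (n : nat).
Implicit Types (u : 'rV[R]_n -> R) (x xi : 'rV[R]_n) (j : 'I_n).
Local Notation leb := (@lebesgue_rV R n).

Let dotp_shift xi x j (t : R) : dotp xi (t *: delta_mx 0 j + x) = t * xi 0 j + dotp xi x.
Proof.
rewrite /dotp (bigD1 j)//= [in RHS](bigD1 j)//= !mxE !eqxx mulr1 mulrDr -addrA mulrC.
congr (_ + (_ + _)); apply: eq_bigr => i ij.
by rewrite !mxE eqxx (negbTE ij) mulr0 add0r.
Qed.

Let measurable_phase xi c : measurable_fun setT (fun x : 'rV[R]_n => dotp xi x + c).
Proof.
by apply: measurable_funD => //; apply: measurable_dotp => //; exact: measurable_cst.
Qed.

Let measurable_line x : measurable_fun setT (fun y : 'rV[R]_n => x + y).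
Proof.
apply: measurable_to_rV => i.
rewrite (_ : _ \o _ = (fun y => x 0 i + @rV_coord R n i y)).
  by apply: measurable_funD => //; exact: measurable_rV_coord.
by apply/funext => y; rewrite /= /rV_coord !mxE.
Qed.

(* Compare the two sides of the difference quotient of u: translation
   invariance moves the quotient onto the cosine. *)
Lemma integration_by_parts_cos u xi c j : real_schwartz u ->
  xi 0 j * \int[leb]_x (sin (dotp xi x + c) * u x) = osc (partials [:: j] u) xi c.
Proof.
move=> su; have sdu := real_schwartz_partials [:: j] su.
have [C C0 hC] := real_schwartz_decay sdu.
pose e : 'rV[R]_n := delta_mx 0 j.
have iu := real_schwartz_integrable su; have mu := real_schwartz_measurable su.
have mdu := real_schwartz_measurable sdu.
have ic c' := integrable_cos_mul (measurable_phase xi c') iu.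
have isn c' := integrable_sin_mul (measurable_phase xi c') iu.
have mus (h : R) : measurable_fun setT (fun x => u (h *: e + x)).
  exact: (measurableT_comp mu (measurable_line (h *: e))).
have lim1 : \int[leb]_x (cos (dotp xi x + c) *
      ((harmonic k)^-1 * (u (harmonic k *: e + x) - u x))) @[k --> \oo] -->
    osc (partials [:: j] u) xi c.
  apply: (@cvg_Rintegral_dominated _ _ _ leb _ _ (fun x => 3 * C * rV_decay x)).
  - move=> k; apply: measurable_funM; first exact: measurable_funcos.
    by apply: measurable_funM => //; exact: measurable_funB.
  - by apply: measurable_funM => //; exact: measurable_funcos.
  - move=> x; apply: cvgM; first exact: cvg_cst.
    by apply: cvg_derive_harmonic; have [/(_ [::])[_ du] _] := su; exact: du.
  - exact: (integrableZl _ (3 * C) (@integrable_rV_decay R n)).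
  - move=> k x; rewrite normrM (le_trans (ler_piMl _ (normr_cos_le1 _)))//.
    by apply: difference_quotient_le => //; rewrite /harmonic/= invr_gt0 ltr0n invf_le1 ?ltr0n// ler1n.
have quot k : \int[leb]_x (cos (dotp xi x + c) *
      ((harmonic k)^-1 * (u (harmonic k *: e + x) - u x))) =
    (harmonic k)^-1 * (cos (harmonic k * - xi 0 j) - 1) * osc u xi c -
    (harmonic k)^-1 * sin (harmonic k * - xi 0 j) *
      \int[leb]_x (sin (dotp xi x + c) * u x).
  set h := harmonic k.
  have ishift : leb.-integrable setT (EFin \o (fun x => cos (dotp xi x + c) * u (h *: e + x))).
    apply: integrable_cos_mul => //; apply/integrableP; split; first exact/measurable_EFinP.
    have /integrableP[_] := iu; rewrite -[X in (X < _)%E -> _](ge0_integral_rV_shift (h *: e)).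
    + by under eq_integral do rewrite addrC.
    + by apply: measurableT_comp => //; exact/measurable_EFinP.
    + by move=> x; exact: abse_ge0.
  transitivity (h^-1 * (\int[leb]_x (cos (dotp xi x + c) * u (h *: e + x)) - osc u xi c)).
    rewrite -RintegralB// -RintegralZl//; last exact: (integrableB measurableT ishift (ic c)).
    by apply: eq_Rintegral => x _; ring.
  have -> : \int[leb]_x (cos (dotp xi x + c) * u (h *: e + x)) =
      \int[leb]_x (cos (dotp xi x + (c + h * - xi 0 j)) * u x).
    rewrite -[RHS](Rintegral_rV_shift (h *: e)); last first.
      by apply: measurable_funM => //; exact: measurable_funcos.
    apply: eq_Rintegral => x _; rewrite [x + _]addrC dotp_shift.
    by congr (cos _ * _); ring.
  have -> : \int[leb]_x (cos (dotp xi x + (c + h * - xi 0 j)) * u x) =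
      cos (h * - xi 0 j) * osc u xi c -
      sin (h * - xi 0 j) * \int[leb]_x (sin (dotp xi x + c) * u x).
    rewrite /osc -!RintegralZl// -RintegralB//; first last.
    - exact: (integrableZl _ _ (isn c)).
    - exact: (integrableZl _ _ (ic c)).
    by apply: eq_Rintegral => x _; rewrite addrA (cosD (dotp xi x + c)); ring.
  by ring.
(* After the translation, the quotients act on cos and sin of -h xi_j, whose derivatives at h = 0
   are 0 and -xi_j. *)
have lim2 : \int[leb]_x (cos (dotp xi x + c) *
      ((harmonic k)^-1 * (u (harmonic k *: e + x) - u x))) @[k --> \oo] -->
    0 * osc u xi c - (- xi 0 j) * \int[leb]_x (sin (dotp xi x + c) * u x).
  rewrite [X in X @ _ --> _](_ : _ = fun k => 
    (harmonic k)^-1 * (cos (harmonic k * - xi 0 j) - 1) * osc u xi c -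
    (harmonic k)^-1 * sin (harmonic k * - xi 0 j) *
      \int[leb]_x (sin (dotp xi x + c) * u x)); last by apply/funext => k; exact: quot.
  have lin : is_derive (0 : R) 1 (fun t => t * - xi 0 j) (- xi 0 j).
    rewrite (_ : (fun t => _) = (- xi 0 j) *: (id : R -> R)); last first.
      by apply/funext => t; rewrite mulrC.
    by have := is_deriveZ (- xi 0 j) (is_derive_id (0 : R) 1); rewrite /GRing.scale/= mulr1.
  have dc : is_derive (0 : R) 1 (fun t => cos (t * - xi 0 j)) (- sin (0 * - xi 0 j) * - xi 0 j).
    exact: (@is_derive1_comp _ cos (fun t => t * - xi 0 j)).
  have ds : is_derive (0 : R) 1 (fun t => sin (t * - xi 0 j)) (cos (0 * - xi 0 j) * - xi 0 j).
    exact: (@is_derive1_comp _ sin (fun t => t * - xi 0 j)).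
  apply: cvgB; (apply: cvgM; last exact: cvg_cst).
    have [dc1 dc2] := dc; have := cvg_derive_harmonic dc1.
    rewrite dc2 mul0r sin0 oppr0 mul0r.
    by under eq_fun do rewrite addr0 /GRing.scale/= mulr1 cos0.
  have [ds1 ds2] := ds; have := cvg_derive_harmonic ds1.
  rewrite ds2 mul0r cos0 mul1r.
  by under eq_fun do rewrite addr0 /GRing.scale/= mulr1 sin0 subr0.
have := cvg_unique _ lim1 lim2; rewrite mul0r sub0r mulNr opprK => <- //.
Qed.

(** Two integrations by parts, at phases c + pi/2 and c, give xi_j^2 [osc] u = - [osc] (d_j^2 u). *)
Lemma osc_sqr_coord u xi c j : real_schwartz u ->
  (1 + xi 0 j ^+ 2) * osc u xi c = osc u xi c - osc (partials [:: j; j] u) xi c.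
Proof.
move=> su; have sdu := real_schwartz_partials [:: j] su.
rewrite mulrDl mul1r; congr (_ + _).
have h1 := integration_by_parts_cos xi (c + pi / 2) j su.
have h2 : _ = osc (partials [:: j; j] u) xi c := integration_by_parts_cos xi c j sdu.
have idu := real_schwartz_integrable sdu.
move: (partials [:: j; j] u) (partials [:: j] u) h1 h2 idu => w v h1 h2 iv.
have E1 : \int[leb]_x (sin (dotp xi x + (c + pi / 2)) * u x) = osc u xi c.
  by apply: eq_Rintegral => x _; rewrite addrA sinDpihalf.
have E2 : osc v xi (c + pi / 2) = - \int[leb]_x (sin (dotp xi x + c) * v x).
  transitivity (\int[leb]_x (-1 * (sin (dotp xi x + c) * v x))).
    by apply: eq_Rintegral => x _; rewrite addrA cosDpihalf mulN1r mulNr.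
  by rewrite RintegralZl ?mulN1r//; exact: integrable_sin_mul.
by rewrite expr2 -mulrA -E1 h1 E2 mulrN h2.
Qed.

Lemma osc_le u : real_schwartz u -> exists C, forall xi c, `|osc u xi c| <= C.
Proof.
move=> su; have iu := real_schwartz_integrable su.
exists (\int[leb]_x `|u x|) => xi c; apply: normr_Rintegral_le.
- apply: measurable_funM; first exact: measurable_funcos.
  exact: real_schwartz_measurable.
- exact: (integrable_abse iu).
- by move=> x; rewrite normrM ler_piMl// normr_cos_le1.
Qed.

(** Multiply by 1 + xi_j^2 one coordinate at a time: each factor is traded for two derivatives, and
    the result is again a transform of Schwartz functions. The induction on the list of coordinates
    therefore quantifies over all Schwartz v. *)
Lemma osc_decay u : real_schwartz u ->
  exists2 C, 0 <= C & forall xi c, `|osc u xi c| <= C * rV_decay xi.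
Proof.
move=> su.
have H (s : seq 'I_n) : forall v, real_schwartz v -> exists C, forall xi c,
    `|(\prod_(j <- s) (1 + xi 0 j ^+ 2)) * osc v xi c| <= C.
  elim: s => [|j s IHs] v sv.
    have [C hC] := osc_le sv; exists C => xi c.
    by rewrite big_nil mul1r.
  have [C1 h1] := IHs _ sv.
  have [C2 h2] := IHs _ (real_schwartz_partials [:: j; j] sv).
  exists (C1 + C2) => xi c; rewrite big_cons mulrAC osc_sqr_coord//.
  rewrite mulrC mulrBr (le_trans (ler_normB _ _))// lerD//.
have [C hC] := H (index_enum 'I_n) u su.
exists C; first by apply: le_trans (hC 0 0).
move=> xi c; rewrite -[`|_|]mul1r -(rV_decayE xi) -mulrA mulrC.
rewrite ler_wpM2r ?rV_decay_ge0// (le_trans _ (hC xi c))//.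
by rewrite normrM ler_wpM2r// ler_norm.
Qed.

End integration_by_parts_rV.

(** * Chaining: telescoping pieces and their L^2 norms *)

Lemma cos_lipschitz (R : realType) (x y : R) : `|cos x - cos y| <= `|x - y|.
Proof.
wlog yx : x y / y <= x.
  move=> h; have [/h//|/ltW/h] := leP y x.
  by rewrite distrC [X in _ <= X -> _]distrC.
have dc z : z \in `]y, x[%R -> is_derive z 1 (@cos R) (- sin z).
  by move=> _; exact: is_derive_cos.
have cc : {within `[y, x], continuous (@cos R)}.
  by apply: continuous_subspaceT; exact: continuous_cos.
have [c _ ->] := MVT_segment yx dc cc.
by rewrite normrM ler_piMl// normrN normr_sin_le1.
Qed.

(** Cauchy-Schwarz for the splitting of s_m as om_m^(1/2) times s_m / om_m^(1/2), by induction on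
    K. *)
Lemma sqr_sum_weighted (R : realType) (s om : nat -> R) K : (forall m, 0 < om m) ->
  (\sum_(m < K) s m) ^+ 2 <= (\sum_(m < K) om m) * \sum_(m < K) (s m ^+ 2 / om m).
Proof.
move=> om0; elim: K => [|K IH]; first by rewrite !big_ord0 expr0n/= mul0r.
rewrite !big_ord_recr/=.
move: IH; have : 0 <= \sum_(m < K) om m by apply: sumr_ge0 => m _; exact: ltW.
have : 0 <= \sum_(m < K) (s m ^+ 2 / om m).
  by apply: sumr_ge0 => m _; rewrite divr_ge0 ?sqr_ge0// ltW.
move: (\sum_(m < K) s m) (\sum_(m < K) om m) (\sum_(m < K) (s m ^+ 2 / om m)).
move=> A W B B0 W0 AWB; have o0 := om0 K; have on0 : om K != 0 by rewrite gt_eqF.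
(* The cross term of the new square: expand (W s_K - om_K A)^2 >= 0 and use A^2 <= W B; if W = 0
   then A = 0. *)
have key : 2 * A * s K <= W * (s K ^+ 2 / om K) + om K * B.
  have [W00|W00] := eqVneq W 0.
    have A0 : A = 0 by apply/eqP; rewrite -sqrf_eq0 eq_le sqr_ge0 andbT; move: AWB; rewrite W00 mul0r.
    by rewrite A0 W00 mulr0 !mul0r add0r mulr_ge0// ltW.
  have {}W0 : 0 < W by rewrite lt_neqAle eq_sym W00.
  have : A ^+ 2 / W <= B by rewrite ler_pdivrMr// mulrC.
  move=> /(ler_wpM2l (ltW o0)) h.
  apply: le_trans (lerD (lexx (W * (s K ^+ 2 / om K))) h).
  rewrite -subr_ge0 (_ : _ - _ = (W * s K - om K * A) ^+ 2 / (W * om K)).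
    by rewrite divr_ge0 ?sqr_ge0// mulr_ge0// ltW.
  by field; rewrite W00 on0.
rewrite sqrrD [leRHS](_ : _ =
  W * B + (W * (s K ^+ 2 / om K) + om K * B) + s K ^+ 2); last by field.
by rewrite lerD2r lerD// -mulr_natl mulrA.
Qed.

Section chaining.
Variables (R : realType) (n : nat).
Local Notation leb := (@lebesgue_rV R n).
Variables (w : 'rV[R]_n -> R) (u : 'rV[R]_n -> R).
Hypothesis mw : measurable_fun setT w.
Hypothesis w0 : forall xi, 0 <= w xi.
Hypothesis iu : leb.-integrable setT (EFin \o u).
Variables (E : set R) (e : nat -> seq R) (par : nat -> R -> R).
Hypothesis parP : forall m tau, tau \in e m.+1 ->
  par m tau \in e m /\ `|tau - par m tau| <= 2 ^- m.
Hypothesis eE : forall t m, E t -> exists2 tau, tau \in e m & `|t - tau| <= 2 ^- m.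
Implicit Types (x xi : 'rV[R]_n) (m : nat) (tau phi t : R).

Let mu : measurable_fun setT u.
Proof. by have /integrableP[/measurable_EFinP] := iu. Qed.

(** With phi equal to 0 or -pi/2 these are the real integrals from which the propagator is
    assembled. *)
Definition evolution t phi x : R :=
  \int[leb]_xi (cos (dotp xi x + (t * w xi + phi)) * u xi).

(** The frequencies for which a change of t by 2^-m alters the phase t w by at most 1. *)
Definition low m xi : R := \1_[set xi | (w xi <= 2 ^+ m)%R] xi.

Lemma lowE m xi : low m xi = (w xi <= 2 ^+ m)%R%:R.
Proof. by rewrite /low indicE; congr (_ _)%:R; apply/idP/idP; rewrite inE. Qed.

Lemma measurable_low m : measurable_fun setT (low m).
Proof.
apply: measurable_indic.
rewrite (_ : [set xi | _] = w @^-1` `]-oo, 2 ^+ m]); last first.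
  by apply/seteqP; split => xi /=; rewrite in_itv.
by rewrite -[X in measurable X]setTI; exact: mw.
Qed.

Lemma normr_low_le1 m xi : `|low m xi| <= 1.
Proof. by rewrite lowE; case: (w xi <= _); rewrite ?normr1 ?normr0. Qed.

Let ilow m : leb.-integrable setT (EFin \o (fun xi => low m xi * u xi)).
Proof.
by apply: integrable_bounded_mul (normr_low_le1 m) iu; exact: measurable_low.
Qed.

Let mphase t phi : measurable_fun setT (fun xi => t * w xi + phi).
Proof. by apply: measurable_funD => //; exact: measurable_funM. Qed.

Let mphase_dotp t phi x : measurable_fun setT (fun xi => dotp xi x + (t * w xi + phi)).
Proof. by apply: measurable_funD => //; exact: measurable_dotpl. Qed.

Definition lowpass m tau phi x : R :=
  \int[leb]_xi (cos (dotp xi x + (tau * w xi + phi)) * (low m xi * u xi)).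

(** One link of the chain: e_m is a net at scale 2^-m, and [par] m sends a point of e_(m+1) to an
    ancestor in e_m. Summed along the ancestors of tau, the pieces telescope to [lowpass]. *)
Definition piece m tau phi x : R :=
  lowpass m tau phi x - (if m is m'.+1 then lowpass m' (par m' tau) phi x else 0).

Definition amplitude m tau phi xi : R := cos (tau * w xi + phi) * low m xi -
  (if m is m'.+1 then cos (par m' tau * w xi + phi) * low m' xi else 0).

(** For m >= 1 this is (w / 2^(m-1))^2 restricted to w <= 2^m; the distance from tau to its ancestor
    is at most 2^-(m-1). *)
Definition gain m xi : R :=
  low m xi * (if m is m'.+1 then 4 * (w xi / 2 ^+ m'.+1) ^+ 2 else 1).

Lemma gain_ge0 m xi : 0 <= gain m xi.
Proof.
rewrite /gain lowE mulr_ge0//; case: m => // m; by rewrite mulr_ge0// sqr_ge0.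
Qed.

(** Where both cut-offs are 1, cosine is 1-Lipschitz and the times differ by at most 2^-m (levels
    m+1 and m). For 2^m < w <= 2^(m+1) only one cosine survives, and it is at most 1 < w / 2^m. *)
Lemma amplitude_le m tau phi xi : tau \in e m -> amplitude m tau phi xi ^+ 2 <= gain m xi.
Proof.
rewrite /amplitude /gain !lowE; case: m => [|m] te.
  rewrite subr0 mulr1 expr0; case: (w xi <= 1); rewrite ?mulr1 ?mulr0 ?expr0n//=.
  by rewrite -real_normK ?num_real// expr_le1// normr_cos_le1.
have [_ d] := parP te.
rewrite [low m xi]lowE; have p2 : (0 : R) < 2 ^+ m by rewrite exprn_gt0.
have mm : (2 ^+ m : R) <= 2 ^+ m.+1 by rewrite exprS ler_peMl ?ler1n// ltW.
have [wm|wm] := leP (w xi) (2 ^+ m).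
  rewrite (le_trans wm mm) !mulr1 mul1r.
  rewrite -[leLHS]real_normK ?num_real// [leRHS](_ : _ = (w xi / 2 ^+ m) ^+ 2); last first.
    by rewrite (exprS 2 m); field; rewrite gt_eqF.
  rewrite ler_sqr ?nnegrE ?divr_ge0 ?(ltW p2)//.
  rewrite (le_trans (cos_lipschitz _ _))//.
  rewrite (_ : _ - _ = (tau - par m tau) * w xi); last by ring.
  by rewrite normrM (ger0_norm (w0 xi)) mulrC ler_wpM2l.
rewrite mulr0 subr0; case: (w xi <= 2 ^+ m.+1); last by rewrite mulr0 expr0n/= mul0r.
rewrite mulr1 mul1r; apply: (@le_trans _ _ 1).
  by rewrite -real_normK ?num_real// expr_le1// normr_cos_le1.
rewrite (_ : 4 * _ = (w xi / 2 ^+ m) ^+ 2); last by rewrite (exprS 2 m); field; rewrite gt_eqF.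
by rewrite expr_ge1 ?divr_ge0 ?(ltW p2)// ler_pdivlMr// mul1r ltW.
Qed.

Lemma measurable_amplitude m tau phi : measurable_fun setT (amplitude m tau phi).
Proof.
apply: measurable_funB.
  by apply: measurable_funM; [exact: measurable_funcos|exact: measurable_low].
case: m => [|m]; first exact: measurable_cst.
by apply: measurable_funM; [exact: measurable_funcos|exact: measurable_low].
Qed.

Lemma normr_amplitude_le2 m tau phi xi : `|amplitude m tau phi xi| <= 2.
Proof.
have b t k : `|cos (t * w xi + phi) * low k xi| <= 1.
  by rewrite normrM mulr_ile1// ?normr_cos_le1 ?normr_low_le1.
rewrite /amplitude (le_trans (ler_normB _ _))// (_ : 2 = 1 + 1 :> R)// lerD//.
by case: m => [|m]; rewrite ?normr0.
Qed.

Lemma integrable_amplitude m tau phi :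
  leb.-integrable setT (EFin \o (fun xi => amplitude m tau phi xi * u xi)).
Proof.
by apply: integrable_bounded_mul (normr_amplitude_le2 m tau phi) iu; exact: measurable_amplitude.
Qed.

(** Addition formula for the cosine, with the sine of the time phase written as a cosine shifted by
    pi/2: a piece becomes a difference of transforms to which [plancherel_le] applies. *)
Lemma pieceE m tau phi x : piece m tau phi x =
  cos_transform (fun xi => amplitude m tau phi xi * u xi) x -
  sin_transform (fun xi => amplitude m tau (phi - pi / 2) xi * u xi) x.
Proof.
have il t k : leb.-integrable setT (EFin \o
    (fun xi => cos (dotp xi x + (t * w xi + phi)) * (low k xi * u xi))).
  exact: integrable_cos_mul.
rewrite /cos_transform /sin_transform -RintegralB//; first last.
- by apply: integrable_sin_mul; [exact: measurable_dotpl|exact: integrable_amplitude].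
- by apply: integrable_cos_mul; [exact: measurable_dotpl|exact: integrable_amplitude].
have sinE (y : R) : sin y = cos (y - pi / 2) by rewrite -sinDpihalf subrK.
have cs t xi : cos (t * w xi + (phi - pi / 2)) = sin (t * w xi + phi).
  by rewrite addrA -sinE.
rewrite /piece; case: m => [|m].
  rewrite subr0; apply: eq_Rintegral => xi _.
  by rewrite /amplitude !subr0 cs (cosD (dotp xi x)); ring.
rewrite -RintegralB//; apply: eq_Rintegral => xi _.
by rewrite /amplitude !cs !(cosD (dotp xi x)); ring.
Qed.

Lemma measurable_piece m tau phi : measurable_fun setT (piece m tau phi).
Proof.
rewrite (_ : piece m tau phi = (fun x =>
  cos_transform (fun xi => amplitude m tau phi xi * u xi) x -
  sin_transform (fun xi => amplitude m tau (phi - pi / 2) xi * u xi) x)).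
  apply: measurable_funB.
    by apply: measurable_cos_transform; exact: integrable_amplitude.
  by apply: measurable_sin_transform; exact: integrable_amplitude.
by apply/funext => x; exact: pieceE.
Qed.

Let G m := (\int[leb]_xi (gain m xi * u xi ^+ 2)%:E)%E.

Lemma measurable_gain m : measurable_fun setT (gain m).
Proof.
apply: measurable_funM; first exact: measurable_low.
case: m => [|m]; first exact: measurable_cst.
by apply: measurable_funM => //; apply: measurable_funX; apply: measurable_funM.
Qed.

(** By [pieceE] the square is at most twice the sum of the squared moduli of two transforms, each
    with energy at most (16 pi)^n G; hence the factor 4. *)
Lemma integral_piece_le m tau phi : tau \in e m ->
  (\int[leb]_x (piece m tau phi x ^+ 2)%:E <= (4 * (16 * pi) ^+ n)%:E * G m)%E.
Proof.
move=> te; set kap := (16 * pi) ^+ n.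
have kap0 : 0 <= kap by rewrite exprn_ge0// mulr_ge0// pi_ge0.
have amp phi' : (\int[leb]_xi ((amplitude m tau phi' xi * u xi) ^+ 2)%:E <= G m)%E.
  apply: ge0_le_integral => //.
  - by move=> xi _; rewrite lee_fin sqr_ge0.
  - apply/measurable_EFinP; apply: measurable_funX; apply: measurable_funM => //.
    exact: measurable_amplitude.
  - apply/measurable_EFinP; apply: measurable_funM; first exact: measurable_gain.
    exact: measurable_funX.
  - by move=> xi _; rewrite lee_fin exprMn ler_wpM2r ?sqr_ge0// amplitude_le.
have tr phi' : let v := (fun xi => amplitude m tau phi' xi * u xi) in
    (\int[leb]_x (cos_transform v x ^+ 2 + sin_transform v x ^+ 2)%:E <= kap%:E * G m)%E.
  move=> v; apply: (le_trans (plancherel_le (integrable_amplitude m tau phi'))).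
  by rewrite lee_wpmul2l// ?lee_fin.
have mc phi' := measurable_cos_transform (integrable_amplitude m tau phi').
have ms phi' := measurable_sin_transform (integrable_amplitude m tau phi').
pose v1 := (fun xi => amplitude m tau phi xi * u xi).
pose v2 := (fun xi => amplitude m tau (phi - pi / 2) xi * u xi).
pose h v x : \bar R := (2 * (cos_transform v x ^+ 2 + sin_transform v x ^+ 2))%:E.
have mh phi' : measurable_fun setT (h (fun xi => amplitude m tau phi' xi * u xi)).
  apply/measurable_EFinP; apply: measurable_funM => //.
  by apply: measurable_funD; exact: measurable_funX.
have h0 v x : (0 <= h v x)%E by rewrite lee_fin mulr_ge0// addr_ge0// sqr_ge0.
apply: (@le_trans _ _ (\int[leb]_x (h v1 x + h v2 x))%E).
  apply: ge0_le_integral => //.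
  - by move=> x _; rewrite lee_fin sqr_ge0.
  - by apply/measurable_EFinP; apply: measurable_funX; exact: measurable_piece.
  - by apply: emeasurable_funD; exact: mh.
  move=> x _; rewrite -EFinD lee_fin pieceE -/v1 -/v2.
  have := sqr_ge0 (cos_transform v1 x + sin_transform v2 x).
  have := sqr_ge0 (sin_transform v1 x); have := sqr_ge0 (cos_transform v2 x).
  nra.
rewrite ge0_integralD//; [|exact: mh|exact: mh].
pose vv phi' xi : R := amplitude m tau phi' xi * u xi.
have half phi' : (\int[leb]_x h (vv phi') x <= 2%:E * (kap%:E * G m))%E.
  rewrite /h; under eq_integral do rewrite EFinM.
  rewrite ge0_integralZl//; first by rewrite lee_wpmul2l ?lee_fin//; exact: tr.
  - by apply/measurable_EFinP; apply: measurable_funD; apply: measurable_funX; [exact: mc|exact: ms].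
  - by move=> x _; rewrite lee_fin addr_ge0// sqr_ge0.
apply: (le_trans (leeD (half _) (half _))).
rewrite !muleA -!EFinM -ge0_muleDl ?lee_fin ?mulr_ge0//.
by rewrite -EFinD (_ : _ + _ = 4 * kap)//; ring.
Qed.

End chaining.

(** * A majorant independent of t, and its integral *)

Section chaining_majorant.
Variables (R : realType) (n : nat).
Local Notation leb := (@lebesgue_rV R n).
Variables (w : 'rV[R]_n -> R) (u : 'rV[R]_n -> R).
Hypothesis mw : measurable_fun setT w.
Hypothesis w0 : forall xi, 0 <= w xi.
Hypothesis iu : leb.-integrable setT (EFin \o u).
Variables (E : set R) (e : nat -> seq R) (par : nat -> R -> R).
Hypothesis parP : forall m tau, tau \in e m.+1 ->
  par m tau \in e m /\ `|tau - par m tau| <= 2 ^- m.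
Hypothesis eE : forall t m, E t -> exists2 tau, tau \in e m & `|t - tau| <= 2 ^- m.
Hypothesis e_gt0 : forall m, (0 < size (e m))%N.
Variables (b Om : R) (G : 'rV[R]_n -> R).
Hypothesis b0 : 0 < b.
Hypothesis OmP : forall K, \sum_(m < K) (size (e m))%:R * b ^- m <= Om.
Hypothesis mG : measurable_fun setT G.
Hypothesis GP : forall K xi, \sum_(m < K) b ^+ m * gain w m xi <= G xi.
Implicit Types (x xi : 'rV[R]_n) (m : nat) (tau t : R).
Variable phi : R.

Let mu : measurable_fun setT u.
Proof. by have /integrableP[/measurable_EFinP] := iu. Qed.

Let om m : R := (size (e m))%:R * b ^- m.

Let om0 m : 0 < om m.
Proof. by rewrite mulr_gt0 ?ltr0n ?e_gt0// invr_gt0 exprn_gt0. Qed.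

Let Om0 : 0 <= Om.
Proof. by apply: le_trans (OmP 0); rewrite big_ord0. Qed.

Let pc m tau x := piece w u par m tau phi x.
(** The sum over the net stands in for the maximum over it; summing costs the factor size(e_m) after
    integration. *)
Let S m x := \sum_(tau <- e m) pc m tau x ^+ 2.

Let S0 m x : 0 <= S m x.
Proof. by apply: sumr_ge0 => tau _; exact: sqr_ge0. Qed.

Let piece_le m tau x : tau \in e m -> `|pc m tau x| <= Num.sqrt (S m x).
Proof.
move=> te; rewrite -sqrtr_sqr ler_sqrt ?S0//.
rewrite /S (big_rem tau)//= lerDl.
by apply: sumr_ge0 => s _; exact: sqr_ge0.
Qed.

Let chain K tau x : tau \in e K ->
  `|lowpass w u K tau phi x| <= \sum_(m < K.+1) Num.sqrt (S m x).
Proof.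
elim: K tau => [|K IH] tau te.
  rewrite big_ord1 (le_trans _ (piece_le x te))//.
  by rewrite /pc /piece subr0.
have [pe _] := parP te.
rewrite big_ord_recr/= addrC -[lowpass _ _ _ _ _ _](subrK (lowpass w u K (par K tau) phi x)).
by rewrite (le_trans (ler_normD _ _))// lerD ?IH// (le_trans _ (piece_le x te)).
Qed.

(** What Cauchy-Schwarz with weights [om] makes of the squared sum of the square roots of S_m, [Om]
    being a bound for the total weight. *)
Definition majorant x : \bar R := (\sum_(0 <= m <oo) (Om / om m * S m x)%:E)%E.

Let term_ge0 m x : 0 <= Om / om m * S m x.
Proof. by rewrite mulr_ge0 ?S0// divr_ge0// ltW. Qed.

Let lowpass_majorant K tau x : tau \in e K ->
  ((lowpass w u K tau phi x ^+ 2)%:E <= majorant x)%E.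
Proof.
move=> te; apply: (@le_trans _ _ (\sum_(0 <= m < K.+1) (Om / om m * S m x)%:E)%E).
  rewrite big_mkord sumEFin lee_fin -real_normK ?num_real//.
  apply: (@le_trans _ _ ((\sum_(m < K.+1) Num.sqrt (S m x)) ^+ 2)).
    by rewrite ler_sqr ?nnegrE ?chain// sumr_ge0// => m _; exact: sqrtr_ge0.
  apply: (le_trans (sqr_sum_weighted (fun m => Num.sqrt (S m x)) K.+1 om0)).
  apply: (@le_trans _ _ (Om * \sum_(m < K.+1) (Num.sqrt (S m x) ^+ 2 / om m))).
    rewrite ler_wpM2r ?OmP// sumr_ge0// => m _.
    by rewrite divr_ge0 ?sqr_ge0// ltW.
  rewrite mulr_sumr; apply: ler_sum => m _.
  by rewrite sqr_sqrtr ?S0// mulrA mulrAC.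
by apply: nneseries_lim_ge => m _ _; rewrite lee_fin.
Qed.

Let pow2_0 : (2 ^- k : R) @[k --> \oo] --> (0 : R).
Proof.
have := @cvg_expr R 2^-1; rewrite ger0_norm ?invr_ge0//.
move=> h; have {}h := h (ltac:(by rewrite invf_lt1 ?ltr1n)).
by under eq_fun do rewrite -exprVn.
Qed.

(** Dominated convergence with bound |u|: the phases converge, and at each fixed frequency the
    cut-off is eventually 1. *)
Let lowpass_cvg t x (tau : nat -> R) : (forall k, `|t - tau k| <= 2 ^- k) ->
  lowpass w u k (tau k) phi x @[k --> \oo] --> evolution w u t phi x.
Proof.
move=> ttau.
have tau_t : tau k @[k --> \oo] --> t.
  apply/cvgrPdist_le => eps eps0.
  have /cvgrPdist_le /(_ eps eps0)[N _ NP] := pow2_0.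
  exists N => // k /NP; rewrite sub0r normrN ger0_norm ?invr_ge0 ?exprn_ge0//.
  exact: le_trans.
apply: (@cvg_Rintegral_dominated _ _ _ leb _ _ (fun xi => `|u xi|)).
- move=> k; apply: measurable_funM.
    apply: measurable_funcos; apply: measurable_funD; first exact: measurable_dotpl.
    by apply: measurable_funD => //; exact: measurable_funM.
  by apply: measurable_funM => //; exact: measurable_low.
- apply: measurable_funM => //.
  apply: measurable_funcos; apply: measurable_funD; first exact: measurable_dotpl.
  by apply: measurable_funD => //; exact: measurable_funM.
- move=> xi; apply: cvgM.
    apply: (cvg_comp (fun k => dotp xi x + (tau k * w xi + phi)) (@cos R) _
      (continuous_cos (x := dotp xi x + (t * w xi + phi)))).
    apply: cvgD; first exact: cvg_cst.
    apply: cvgD; last exact: cvg_cst.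
    by apply: cvgM; [exact: tau_t|exact: cvg_cst].
  rewrite -[X in _ --> X]mul1r; apply: cvgM; last exact: cvg_cst.
  have one : (fun=> 1 : R) @ \oo --> (1 : R) by exact: cvg_cst.
  apply: cvg_trans one; apply: near_eq_cvg.
  (* For k beyond the integer part of w(xi), w(xi) <= k <= 2^k. *)
  exists (Num.truncn (w xi)).+1 => // k /= Nk; rewrite lowE.
  rewrite (_ : w xi <= 2 ^+ k)//.
  apply: (@le_trans _ _ k%:R); last by rewrite -natrX ler_nat ltnW// ltn_expl.
  by rewrite ltW// (lt_le_trans (truncnS_gt _))// ler_nat.
- exact: (integrable_abse iu).
- move=> k xi; rewrite !normrM.
  by rewrite mulrA ler_piMl// mulr_ile1// ?normr_cos_le1 ?normr_low_le1.
Qed.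

(** Choose tau_k in e_k within 2^-k of t; the bound for [lowpass] at tau_k does not depend on k, so
    it passes to the limit. *)
Lemma evolution_majorant t x : E t ->
  ((evolution w u t phi x ^+ 2)%:E <= majorant x)%E.
Proof.
move=> Et.
have /choice[tau tauP] : forall k, exists s, s \in e k /\ `|t - s| <= 2 ^- k.
  by move=> k; have [s se ts] := eE k Et; exists s.
have lim : lowpass w u k (tau k) phi x @[k --> \oo] --> evolution w u t phi x.
  by apply: lowpass_cvg => k; exact: (tauP k).2.
have lim2 : (lowpass w u k (tau k) phi x ^+ 2)%:E @[k --> \oo] -->
    (evolution w u t phi x ^+ 2)%:E.
  by apply: cvg_EFin; [exact: nearW|rewrite expr2; exact: (cvgM lim lim)].
have cl2 := cvgP _ lim2; rewrite -(cvg_lim _ lim2)//.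
apply: lime_le => //.
by apply: nearW => k; apply: lowpass_majorant; exact: (tauP k).1.
Qed.

Let mterm m : measurable_fun setT (fun x => (Om / om m * S m x)%:E).
Proof.
apply/measurable_EFinP; apply: measurable_funM => //; apply: measurable_sum => tau.
by apply: measurable_funX; exact: measurable_piece.
Qed.

Lemma majorant_ge0 x : (0 <= majorant x)%E.
Proof. by apply: nneseries_ge0 => m _ _; rewrite lee_fin. Qed.

Lemma measurable_majorant : measurable_fun setT majorant.
Proof.
apply: (ge0_emeasurable_sum (h := fun m x => (Om / om m * S m x)%:E) (P := xpredT)) => //.
by move=> m x _ _; rewrite lee_fin.
Qed.

(** Level m contributes Om / om_m times size(e_m) equal bounds from [integral_piece_le]. Since om_m
    = size(e_m) b^-m, the size cancels and Om b^m is left, so the hypothesis on sum_m b^m gain_m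
    finishes the estimate. *)
Lemma integral_majorant : (\int[leb]_x majorant x <=
  (4 * (16 * pi) ^+ n * Om)%:E * \int[leb]_xi (G xi * u xi ^+ 2)%:E)%E.
Proof.
set c := 4 * (16 * pi) ^+ n * Om.
have c0 : 0 <= c by rewrite !mulr_ge0// exprn_ge0// mulr_ge0// pi_ge0.
have gu0 m xi : 0 <= b ^+ m * gain w m xi * u xi ^+ 2.
  apply: mulr_ge0; last exact: sqr_ge0.
  by apply: mulr_ge0; [rewrite exprn_ge0// ltW|exact: gain_ge0].
have mgu m : measurable_fun setT (fun xi => (b ^+ m * gain w m xi * u xi ^+ 2)%:E).
  apply/measurable_EFinP; apply: measurable_funM; last exact: measurable_funX.
  by apply: measurable_funM => //; exact: measurable_gain.
rewrite integral_nneseries//; last by move=> m x _; rewrite lee_fin.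
apply: (@le_trans _ _ (\sum_(0 <= m <oo) (c%:E *
    \int[leb]_xi (b ^+ m * gain w m xi * u xi ^+ 2)%:E))%E).
  apply: lee_nneseries => m _.
    by move=> _; apply: integral_ge0 => x _; rewrite lee_fin.
  under eq_integral do rewrite EFinM.
  rewrite ge0_integralZl//; first last.
  - by rewrite lee_fin divr_ge0// ltW.
  - by move=> x _; rewrite lee_fin.
  - apply/measurable_EFinP; apply: measurable_sum => tau.
    by apply: measurable_funX; exact: measurable_piece.
  have -> : (\int[leb]_x (S m x)%:E = \sum_(tau <- e m) \int[leb]_x (pc m tau x ^+ 2)%:E)%E.
    rewrite -ge0_integral_sum//.
    - by apply: eq_integral => x _; rewrite sumEFin.
    - by move=> tau; apply/measurable_EFinP; apply: measurable_funX; exact: measurable_piece.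
    - by move=> tau x _; rewrite lee_fin sqr_ge0.
  pose I := (\int[leb]_xi (gain w m xi * u xi ^+ 2)%:E)%E.
  apply: (@le_trans _ _ ((Om / om m)%:E * \sum_(tau <- e m) ((4 * (16 * pi) ^+ n)%:E * I))%E).
    apply: lee_wpmul2l; first by rewrite lee_fin divr_ge0// ltW.
    rewrite !big_seq; apply: lee_sum => tau te.
    exact: (integral_piece_le mw w0 iu parP).
  have I0 : (0 <= I)%E.
    by apply: integral_ge0 => xi _; rewrite lee_fin mulr_ge0 ?gain_ge0 ?sqr_ge0.
  have -> : (\int[leb]_xi (b ^+ m * gain w m xi * u xi ^+ 2)%:E = (b ^+ m)%:E * I)%E.
    under eq_integral do rewrite -mulrA EFinM.
    rewrite ge0_integralZl// ?lee_fin ?exprn_ge0 ?(ltW b0)//.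
    - apply/measurable_EFinP; apply: measurable_funM; last exact: measurable_funX.
      exact: measurable_gain.
    - by move=> xi _; rewrite lee_fin mulr_ge0 ?gain_ge0 ?sqr_ge0.
  have -> (X : \bar R) (r : seq R) : (\sum_(tau <- r) X = (size r)%:R%:E * X)%E.
    elim: r => [|t r IHr]; first by rewrite big_nil mul0e.
    by rewrite big_cons IHr /= -natr1 EFinD ge0_muleDl ?lee_fin// mul1e addeC.
  rewrite !muleA -!EFinM (_ : Om / om m * (size (e m))%:R * (4 * (16 * pi) ^+ n) = c * b ^+ m)//.
  rewrite /c /om; field; rewrite !gt_eqF ?exprn_gt0 ?ltr0n ?e_gt0//.
rewrite nneseriesZl//; last by move=> m *; apply: integral_ge0 => x _; rewrite lee_fin.
rewrite lee_wpmul2l ?lee_fin// -integral_nneseries//; last by move=> m x _; rewrite lee_fin.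
apply: ge0_le_integral => //.
- by move=> xi _; apply: nneseries_ge0 => m _ _; rewrite lee_fin.
- apply: (ge0_emeasurable_sum (P := xpredT)
    (h := fun m xi => (b ^+ m * gain w m xi * u xi ^+ 2)%:E)) => //.
  by move=> m xi _ _; rewrite lee_fin.
- by apply/measurable_EFinP; apply: measurable_funM => //; exact: measurable_funX.
move=> xi _; apply: lime_le.
  by apply: is_cvg_nneseries => m _ _; rewrite lee_fin.
apply: nearW => K; rewrite big_mkord sumEFin lee_fin -mulr_suml.
by rewrite ler_wpM2r ?sqr_ge0.
Qed.

End chaining_majorant.

(** * Summing the gains over the levels *)

Section gain_sum.
Variable R : realType.
Implicit Types (y sigma beta : R).

Lemma one_powR beta : (1 : R) `^ beta = 1.
Proof. by rewrite powR1. Qed.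

Lemma powR_exprn y beta k : 0 <= y -> (y ^+ k) `^ beta = (y `^ beta) ^+ k.
Proof.
move=> y0; elim: k => [|k IHk]; first by rewrite !expr0 one_powR.
by rewrite [in LHS]exprS [in RHS]exprS powRM ?exprn_ge0// IHk.
Qed.

Lemma two_powR_gt1 beta : 0 < beta -> 1 < (2 : R) `^ beta.
Proof.
by move=> beta0; rewrite -[ltLHS](one_powR beta) gt0_ltr_powR ?nnegrE// ltr1n.
Qed.

Lemma two_powRN_lt1 beta : 0 < beta -> (2 : R) `^ (- beta) < 1.
Proof. by move=> beta0; rewrite powRN invf_lt1 ?powR_gt0// two_powR_gt1. Qed.

(** Only levels with 2^m >= y count; there the terms are geometric of ratio 2^-beta and start at a
    value at most 1. *)
Lemma dyadic_geometric_sum_le beta y K : 0 < beta -> 0 <= y ->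
  \sum_(m < K) (if y / 2 ^+ m <= 1 then (y / 2 ^+ m) `^ beta else 0) <=
  (1 - 2 `^ (- beta))^-1.
Proof.
move=> beta0 y0; set rho := 2 `^ (- beta).
have rho1 : rho < 1 := two_powRN_lt1 beta0.
have d0 : 0 < 1 - rho by rewrite subr_gt0.
have half z : 0 <= z -> (z / 2) `^ beta = rho * z `^ beta.
  by move=> z0; rewrite powRM ?invr_ge0// -powR_inv1// -powRrM mulN1r mulrC.
(* The induction replaces y by y/2; once y <= 1 it needs the sharper bound with the factor
   y^beta. *)
suff [//] : \sum_(m < K) (if y / 2 ^+ m <= 1 then (y / 2 ^+ m) `^ beta else 0) <=
    (1 - rho)^-1 /\ (y <= 1 -> \sum_(m < K) (if y / 2 ^+ m <= 1 then (y / 2 ^+ m) `^ beta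
      else 0) <= y `^ beta / (1 - rho)).
elim: K y y0 => [|K IH] y y0.
  by rewrite !big_ord0 invr_ge0 (ltW d0); split => // _; rewrite divr_ge0 ?powR_ge0 ?ltW.
have y20 : 0 <= y / 2 by rewrite divr_ge0.
have [IH1 IH2] := IH _ y20.
rewrite big_ord_recl expr0 divr1.
have -> : \sum_(i < K) (if y / 2 ^+ lift ord0 i <= 1 then (y / 2 ^+ lift ord0 i) `^ beta else 0) =
    \sum_(i < K) (if y / 2 / 2 ^+ i <= 1 then (y / 2 / 2 ^+ i) `^ beta else 0).
  by apply: eq_bigr => i _; rewrite lift0 exprS invfM mulrA.
have [y1|y1] := leP y 1; last by split => //; rewrite add0r.
have y21 : y / 2 <= 1 by rewrite ler_pdivrMr// mul1r (le_trans y1)// ler1n.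
have bound : y `^ beta + \sum_(i < K) (if y / 2 / 2 ^+ i <= 1 then (y / 2 / 2 ^+ i) `^ beta else 0)
    <= y `^ beta / (1 - rho).
  rewrite (le_trans (lerD (lexx _) (IH2 y21)))// half//.
  rewrite (_ : _ + _ = y `^ beta / (1 - rho))//; field; exact/lt0r_neq0.
split=> //; rewrite (le_trans bound)// ler_piMl ?invr_ge0 ?(ltW d0)//.
by rewrite -[leRHS](one_powR beta) ge0_ler_powR ?nnegrE// ltW.
Qed.

(** For m >= 1, b^m 4 (w/2^m)^2 = 4 w^(2 sigma) (w/2^m)^(2 - 2 sigma), restricted to w <= 2^m; sigma
    < 1 makes the last exponent positive. Level 0 contributes the summand 1. *)
Lemma gain_sum_le n (w : 'rV[R]_n -> R) (xi : 'rV[R]_n) sigma K :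
  0 <= w xi -> 0 < sigma < 1 ->
  \sum_(m < K) (2 `^ (2 * sigma)) ^+ m * gain w m xi <=
  1 + 4 / (1 - 2 `^ (- (2 - 2 * sigma))) * w xi `^ (2 * sigma).
Proof.
move=> w0 /andP[s0 s1]; set b := 2 `^ (2 * sigma); set rho := 2 `^ _.
have beta0 : 0 < 2 - 2 * sigma by rewrite subr_gt0 gtr_pMr.
have term m : b ^+ m.+1 * gain w m.+1 xi <= 4 * w xi `^ (2 * sigma) *
    (if w xi / 2 ^+ m.+1 <= 1 then (w xi / 2 ^+ m.+1) `^ (2 - 2 * sigma) else 0).
  rewrite /gain lowE [in leRHS]ler_pdivrMr ?exprn_gt0// mul1r.
  case: ifP => _; last by rewrite mul0r !mulr0.
  rewrite mul1r.
  have p2 : (0 : R) < 2 ^+ m.+1 by rewrite exprn_gt0.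
  (* Adding exponents of real powers below needs a nonzero base. *)
  have [w00|w00] := eqVneq (w xi) 0.
    rewrite w00 mul0r expr0n/= !mulr0.
    by rewrite !mulr_ge0 ?powR_ge0.
  set y := w xi / 2 ^+ m.+1; have y0 : y != 0 by rewrite mulf_neq0// invr_neq0 ?gt_eqF.
  have y_ge0 : 0 <= y by rewrite divr_ge0// ltW.
  have -> : w xi `^ (2 * sigma) = y `^ (2 * sigma) * b ^+ m.+1.
    rewrite -{1}[w xi](divfK (lt0r_neq0 p2)) -/y powRM ?(ltW p2)//; congr (_ * _).
    exact: powR_exprn.
  rewrite [leRHS](_ : _ = 4 * b ^+ m.+1 * (y `^ (2 * sigma) * y `^ (2 - 2 * sigma))); last by ring.
  rewrite -powRD ?y0 ?implybT// addrC subrK powR_mulrn//.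
  by rewrite mulrA (mulrC 4).
case: K => [|K].
  rewrite big_ord0 addr_ge0// mulr_ge0 ?powR_ge0// divr_ge0// subr_ge0 ltW//.
  exact: two_powRN_lt1.
rewrite big_ord_recl expr0 mul1r lerD//.
  by rewrite /gain mulr1 (le_trans (ler_norm _))// normr_low_le1.
apply: (@le_trans _ _ (4 * w xi `^ (2 * sigma) * \sum_(m < K.+1)
   (if w xi / 2 ^+ m <= 1 then (w xi / 2 ^+ m) `^ (2 - 2 * sigma) else 0))).
  rewrite big_ord_recl/= mulrDr mulr_sumr ler_wpDl//.
    rewrite mulr_ge0 ?mulr_ge0 ?powR_ge0//.
    by case: ifP => // _; exact: powR_ge0.
  by apply: ler_sum => m _; exact: (term m).
rewrite -mulrA -mulrA; apply: ler_wpM2l => //; rewrite mulrC.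
by apply: ler_wpM2r; [exact: powR_ge0|exact: dyadic_geometric_sum_le].
Qed.

End gain_sum.

(** * From the complex propagator to real oscillatory integrals *)

(** The integral of a nonnegative function is a supremum over simple functions below it, so
    monotonicity holds with no measurability. It serves for the maximal function, a supremum over a
    possibly uncountable set of times. *)
Lemma ge0_le_integral_upper d (T : measurableType d) (R : realType)
    (mu : {measure set T -> \bar R}) (f g : T -> \bar R) :
  (forall x, 0 <= f x)%E -> (forall x, f x <= g x)%E ->
  (\int[mu]_x f x <= \int[mu]_x g x)%E.
Proof.
move=> f0 fg.
rewrite !ge0_integralTE//; last by move=> x; exact: le_trans (fg x).
by apply: le_ereal_sup => _ [h hf <-]; exists h => // x; exact: le_trans (fg x).
Qed.

Lemma modc_sqr (R : realType) (z : R[i]) :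
  modc z ^+ 2 = complex.Re z ^+ 2 + complex.Im z ^+ 2.
Proof. by case: z => x y; rewrite /modc/= sqr_sqrtr// addr_ge0// sqr_ge0. Qed.

Section fourier_parts.
Variables (R : realType) (n : nat) (f : 'rV[R]_n -> R[i]).
Hypothesis sf : schwartz f.
Local Notation f1 := (fun x => complex.Re (f x)).
Local Notation f2 := (fun x => complex.Im (f x)).
Local Notation leb := (@lebesgue_rV R n).

Let sf1 : real_schwartz f1. Proof. exact: sf.1. Qed.
Let sf2 : real_schwartz f2. Proof. exact: sf.2. Qed.

Let sin_cos (y : R) : sin y = cos (y - pi / 2).
Proof. by rewrite -sinDpihalf subrK. Qed.

Let mphase xi c : measurable_fun setT (fun x : 'rV[R]_n => dotp xi x + c).
Proof.
by apply: measurable_funD => //; apply: measurable_dotp => //; exact: measurable_cst.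
Qed.

Let iosc (g : 'rV[R]_n -> R) xi c : real_schwartz g ->
  leb.-integrable setT (EFin \o (fun x => cos (dotp xi x + c) * g x)).
Proof.
by move=> sg; apply: integrable_cos_mul => //; exact: real_schwartz_integrable.
Qed.

(** Writing the sine as a cosine of phase -pi/2 puts the transform in terms of [osc], whose decay
    gives integrability. *)
Lemma Re_fourier xi :
  complex.Re (fourier f xi) = osc f1 xi 0 + osc f2 xi (- (pi / 2)).
Proof.
rewrite /osc -RintegralD//; [|exact: iosc|exact: iosc].
apply: eq_Rintegral => x _; rewrite addr0 -sin_cos.
by case: (f x) => u v /=; rewrite cosN sinN; ring.
Qed.

Lemma Im_fourier xi :
  complex.Im (fourier f xi) = osc f2 xi 0 - osc f1 xi (- (pi / 2)).
Proof.
rewrite /osc -RintegralB//; [|exact: iosc|exact: iosc].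
apply: eq_Rintegral => x _; rewrite addr0 -sin_cos.
by case: (f x) => u v /=; rewrite cosN sinN; ring.
Qed.

Lemma measurable_osc (g : 'rV[R]_n -> R) c : real_schwartz g ->
  measurable_fun setT (fun xi => osc g xi c).
Proof.
move=> sg; apply: (@measurable_Rintegral_param _ _ _ _ _ leb
  (fun xi x => cos (dotp xi x + c) * g x)).
apply: measurable_funM.
  apply: measurable_funcos; apply: measurable_funD => //; exact: measurable_dotp.
by apply: measurableT_comp => //; exact: real_schwartz_measurable.
Qed.

Let integrable_osc (g : 'rV[R]_n -> R) c : real_schwartz g ->
  leb.-integrable setT (EFin \o (fun xi => osc g xi c)).
Proof.
move=> sg; have [C _ hC] := osc_decay sg.
apply: (@integrable_dominated _ _ _ leb _ (fun xi => C * rV_decay xi)).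
- exact: measurable_osc.
- exact: (integrableZl _ C (@integrable_rV_decay R n)).
- by move=> xi; exact: hC.
Qed.

Lemma integrable_Re_fourier :
  leb.-integrable setT (EFin \o (fun xi => complex.Re (fourier f xi))).
Proof.
rewrite (_ : EFin \o _ = ((EFin \o (fun xi => osc f1 xi 0%R)) \+
    (EFin \o (fun xi => osc f2 xi (- (pi / 2))%R)))%E).
  by apply: integrableD => //; exact: integrable_osc.
by apply/funext => xi; rewrite [LHS]/comp Re_fourier.
Qed.

Lemma integrable_Im_fourier :
  leb.-integrable setT (EFin \o (fun xi => complex.Im (fourier f xi))).
Proof.
rewrite (_ : EFin \o _ = ((EFin \o (fun xi => osc f2 xi 0%R)) \-
    (EFin \o (fun xi => osc f1 xi (- (pi / 2))%R)))%E).
  by apply: integrableB => //; exact: integrable_osc.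
by apply/funext => xi; rewrite [LHS]/comp Im_fourier.
Qed.

Variable a : R.
Let w (xi : 'rV[R]_n) := enorm xi `^ a.

Lemma measurable_enorm_powR : measurable_fun setT w.
Proof.
by apply: (measurableT_comp (measurable_powR _)); exact: measurable_enorm.
Qed.

(** The real and imaginary parts of the integral are each a sum or difference of two real
    evolutions, whose square is at most twice the sum of the squares. *)
Lemma modc_propagator_le t x : modc (propagator a t f x) ^+ 2 <=
  (2 * pi) ^- n ^+ 2 *
  (2 * (evolution w (fun xi => complex.Re (fourier f xi)) t 0 x ^+ 2 +
        evolution w (fun xi => complex.Im (fourier f xi)) t (- (pi / 2)) x ^+ 2 +
        evolution w (fun xi => complex.Im (fourier f xi)) t 0 x ^+ 2 +
        evolution w (fun xi => complex.Re (fourier f xi)) t (- (pi / 2)) x ^+ 2)).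
Proof.
set F1 := fun xi => complex.Re (fourier f xi).
set F2 := fun xi => complex.Im (fourier f xi).
have iev (F : 'rV[R]_n -> R) c : leb.-integrable setT (EFin \o F) ->
    leb.-integrable setT (EFin \o (fun xi => cos (dotp xi x + (t * w xi + c)) * F xi)).
  apply: integrable_cos_mul; apply: measurable_funD; first exact: measurable_dotpl.
  by apply: measurable_funD => //; apply: measurable_funM => //; exact: measurable_enorm_powR.
have i1 := integrable_Re_fourier; have i2 := integrable_Im_fourier.
rewrite /propagator; set I := cintegral _.
have ReI : complex.Re I = evolution w F1 t 0 x - evolution w F2 t (- (pi / 2)) x.
  rewrite /evolution -RintegralB//; [|exact: iev|exact: iev].
  apply: eq_Rintegral => xi _; rewrite /F1 /F2 addr0 addrA -sin_cos cosD sinD.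
  by case: (fourier f xi) => u v /=; rewrite -/(w xi); ring.
have ImI : complex.Im I = evolution w F2 t 0 x + evolution w F1 t (- (pi / 2)) x.
  rewrite /evolution -RintegralD//; [|exact: iev|exact: iev].
  apply: eq_Rintegral => xi _; rewrite /F1 /F2 addr0 addrA -sin_cos cosD sinD.
  by case: (fourier f xi) => u v /=; rewrite -/(w xi); ring.
have -> : modc (((2 * pi) ^- n)%:C%C * I) ^+ 2 =
    (2 * pi) ^- n ^+ 2 * (complex.Re I ^+ 2 + complex.Im I ^+ 2).
  by rewrite modc_sqr; case: (I) => u v /=; ring.
rewrite ler_wpM2l ?sqr_ge0// ReI ImI.
move: (evolution w F1 t 0 x) (evolution w F2 t (- (pi / 2)) x).
move: (evolution w F2 t 0 x) (evolution w F1 t (- (pi / 2)) x) => p q r s.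
have := sqr_ge0 (r + s); have := sqr_ge0 (p - q); nra.
Qed.

End fourier_parts.

(** * The maximal estimate from a family of nets *)

Lemma ereal_sup_sqr_le (R : realType) (A : set \bar R) (Q : \bar R) :
  (0 <= Q)%E -> (forall r, A r -> exists2 y : R, r = y%:E & 0 <= y /\ ((y ^+ 2)%:E <= Q)%E) ->
  (`|ereal_sup (0%E |` A)| ^+ 2 <= Q)%E.
Proof.
move=> + AQ; case: Q AQ => [q AQ|_ _|//]; last exact: leey.
rewrite lee_fin => q0.
have M0 : (0 <= ereal_sup (0%E |` A))%E by apply: ereal_sup_ubound; left.
have Mq : (ereal_sup (0%E |` A) <= (Num.sqrt q)%:E)%E.
  apply: ge_ereal_sup => _ [->|/AQ[y -> [y0]]].
    by rewrite lee_fin sqrtr_ge0.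
  by rewrite !lee_fin => yq; rewrite -[y]ger0_norm// -sqrtr_sqr ler_sqrt.
rewrite gee0_abs// expe2; apply: le_trans (lee_pmul M0 M0 Mq Mq) _.
by rewrite -EFinM -expr2 sqr_sqrtr.
Qed.

Lemma ge0_sum4E (R : realType) (x y : \bar R) : (0 <= x)%E -> (0 <= y)%E ->
  (x + y + y + x = 2%:E * (x + y))%E.
Proof.
move=> x0 y0; rewrite (_ : 2%:E = 1%:E + 1%:E)%E; last by rewrite -EFinD.
rewrite ge0_muleDl// ?lee_fin// !mul1e -addeA; congr (_ + _)%E.
by rewrite addeC.
Qed.

Section maximal_bound.
Variables (R : realType) (n : nat) (a s sigma Om : R) (E E0 : set R) (e : nat -> seq R).
Hypothesis a0 : 0 < a.
Hypothesis sigma01 : 0 < sigma < 1.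
Hypothesis sigma_s : sigma * a <= s.
Hypothesis EE0 : E `<=` E0.
Hypothesis eE0 : forall m tau, tau \in e m -> E0 tau.
Hypothesis E0e : forall t m, E0 t -> exists2 tau, tau \in e m & `|t - tau| <= 2 ^- m.
Hypothesis e_gt0 : forall m, (0 < size (e m))%N.
Hypothesis OmP : forall K, \sum_(m < K) (size (e m))%:R * (2 `^ (2 * sigma)) ^- m <= Om.
Local Notation leb := (@lebesgue_rV R n).

Let weight (xi : 'rV[R]_n) : R := (1 + enorm xi ^+ 2) `^ s.
Let C2 : R := 1 + 4 / (1 - 2 `^ (- (2 - 2 * sigma))).
Let w (xi : 'rV[R]_n) : R := enorm xi `^ a.

Let C2_ge1 : 1 <= C2.
Proof.
rewrite lerDl divr_ge0// subr_ge0 ltW// two_powRN_lt1//.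
by have /andP[_ s1] := sigma01; rewrite subr_gt0 gtr_pMr.
Qed.

Let base_ge1 (xi : 'rV[R]_n) : 1 <= 1 + enorm xi ^+ 2.
Proof. by rewrite lerDl sqr_ge0. Qed.

Let weight_ge0 xi : 0 <= weight xi. Proof. exact: powR_ge0. Qed.

Let mweight : measurable_fun setT weight.
Proof.
apply: (measurableT_comp (measurable_powR _)); apply: measurable_funD => //.
by apply: measurable_funX; exact: measurable_enorm.
Qed.

(** By [gain_sum_le], since w^(2 sigma) = (|xi|^2)^(sigma a) <= (1 + |xi|^2)^s when sigma a <= s. *)
Let gain_weight K xi :
  \sum_(m < K) (2 `^ (2 * sigma)) ^+ m * gain w m xi <= C2 * weight xi.
Proof.
apply: (le_trans (gain_sum_le K (powR_ge0 _ _) sigma01)).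
have /andP[sg0 _] := sigma01.
have w1 : 1 <= weight xi.
  rewrite /weight -[leLHS](powRr0 (1 + enorm xi ^+ 2)) ler_powR//.
  by rewrite (le_trans _ sigma_s)// mulr_ge0 ?ltW.
have ww : w xi `^ (2 * sigma) <= weight xi.
  rewrite /w -powRrM (_ : a * (2 * sigma) = 2 * (sigma * a)); last by ring.
  rewrite powRrM powR_mulrn ?enorm_ge0//.
  apply: (@le_trans _ _ ((1 + enorm xi ^+ 2) `^ (sigma * a))); last exact: ler_powR.
  have sa : 0 <= sigma * a by rewrite mulr_ge0 ?ltW.
  by apply: ge0_ler_powR; rewrite ?nnegrE ?sqr_ge0 ?lerDr// addr_ge0// sqr_ge0.
have D0 : 0 <= 4 / (1 - 2 `^ (- (2 - 2 * sigma))).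
  by move: C2_ge1; rewrite /C2 lerDl.
rewrite [leRHS]mulrDl mul1r; apply: lerD => //.
exact: ler_wpM2l.
Qed.

(** The nets live in a set E0 containing E, and sigma is kept apart from s/a, so that one statement
    covers both ranges of s. The proof dominates the squared maximal function by four majorants, for
    the real and imaginary parts of the Fourier transform at phases 0 and -pi/2. *)
Lemma maximal_bound : exists C : R, forall f : 'rV[R]_n -> R[i], schwartz f ->
  ((\int[leb]_x (`| maximal a E f x | ^+ 2)) `^ 2^-1 <= C%:E * sobolev_norm s f)%E.
Proof.
(* Net points lie in E0, so the next coarser net has a point near them; 0 is a default value off the
   nets. *)
have /choice[par' parP'] : forall mt : nat * R, exists p : R,
    mt.2 \in e mt.1.+1 -> p \in e mt.1 /\ `|mt.2 - p| <= 2 ^- mt.1.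
  move=> [m tau]; have [te|nte] := boolP (tau \in e m.+1); last by exists 0.
  by have [p pe tp] := E0e m (eE0 te); exists p.
pose par m tau := par' (m, tau).
have parP m tau : tau \in e m.+1 -> par m tau \in e m /\ `|tau - par m tau| <= 2 ^- m.
  exact: (parP' (m, tau)).
pose b : R := 2 `^ (2 * sigma).
have b0 : 0 < b by rewrite powR_gt0.
have Om0 : 0 <= Om by apply: le_trans (OmP 0); rewrite big_ord0.
pose c : R := 4 * (16 * pi) ^+ n * Om.
have c0 : 0 <= c by rewrite !mulr_ge0// exprn_ge0// mulr_ge0// pi_ge0.
pose d : R := (2 * pi) ^- n ^+ 2 * 2.
have d0 : 0 <= d := mulr_ge0 (sqr_ge0 _) (ler0n R 2).
(* d comes from [modc_propagator_le], c from [integral_majorant] and C2 from [gain_weight]; the 2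
   counts the two phases. C bounds squared norms, so its square root is the witness. *)
pose C : R := d * (2 * (c * C2)).
have C20 : 0 <= C2 by rewrite (le_trans _ C2_ge1).
have C0 : 0 <= C := mulr_ge0 d0 (mulr_ge0 (ler0n R 2) (mulr_ge0 c0 C20)).
exists (C `^ 2^-1) => f sf.
pose F1 := fun xi => complex.Re (fourier f xi).
pose F2 := fun xi => complex.Im (fourier f xi).
have i1 : leb.-integrable setT (EFin \o F1) := integrable_Re_fourier sf.
have i2 : leb.-integrable setT (EFin \o F2) := integrable_Im_fourier sf.
have mw : measurable_fun setT w := measurable_enorm_powR a.
have w0 xi : 0 <= w xi := powR_ge0 _ _.
pose maj (F : 'rV[R]_n -> R) c' := majorant w F e par b Om c'.
have maj0 (F : 'rV[R]_n -> R) c' x : (0 <= maj F c' x)%E by apply: majorant_ge0.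
have mmaj (F : 'rV[R]_n -> R) c' : leb.-integrable setT (EFin \o F) ->
    measurable_fun setT (maj F c').
  by move=> iF; exact: (measurable_majorant mw iF par e_gt0 b0 OmP c').
have majE (F : 'rV[R]_n -> R) c' t x : leb.-integrable setT (EFin \o F) -> E t ->
    ((evolution w F t c' x ^+ 2)%:E <= maj F c' x)%E.
  by move=> iF /EE0 Et; exact: (evolution_majorant mw iF parP E0e e_gt0 b0 OmP c' x Et).
pose Nrm (F : 'rV[R]_n -> R) := (\int[leb]_xi (weight xi * F xi ^+ 2)%:E)%E.
have mweightF (F : 'rV[R]_n -> R) : leb.-integrable setT (EFin \o F) ->
    measurable_fun setT (fun xi => (weight xi * F xi ^+ 2)%:E).
  move=> /integrableP[/measurable_EFinP mF _]; apply/measurable_EFinP.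
  by apply: measurable_funM => //; exact: measurable_funX.
have Nrm0 (F : 'rV[R]_n -> R) : (0 <= Nrm F)%E.
  by apply: integral_ge0 => xi _; rewrite lee_fin mulr_ge0 ?sqr_ge0.
have intmaj (F : 'rV[R]_n -> R) c' : leb.-integrable setT (EFin \o F) ->
    (\int[leb]_x maj F c' x <= (c * C2)%:E * Nrm F)%E.
  move=> iF.
  have mG : measurable_fun setT (fun xi => C2 * weight xi) by exact: measurable_funM.
  apply: (le_trans (integral_majorant mw w0 iF parP e_gt0 b0 OmP mG gain_weight c')).
  rewrite -/c [(c * C2)%:E]EFinM -[leRHS]muleA; apply: lee_wpmul2l; first by rewrite lee_fin.
  under eq_integral do rewrite -mulrA EFinM.
  rewrite ge0_integralZl//; first exact: mweightF.
  by move=> xi _; rewrite lee_fin mulr_ge0 ?sqr_ge0.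
have step3 : (Nrm F1 + Nrm F2 = \int[leb]_xi
    ((1 + enorm xi ^+ 2) `^ s * modc (fourier f xi) ^+ 2)%:E)%E.
  rewrite -ge0_integralD//; first last.
  - exact: mweightF.
  - by move=> xi _; rewrite lee_fin mulr_ge0 ?sqr_ge0.
  - exact: mweightF.
  - by move=> xi _; rewrite lee_fin mulr_ge0 ?sqr_ge0.
  by apply: eq_integral => xi _; rewrite -EFinD modc_sqr mulrDr.
clearbody maj Nrm.
pose Q x := (d%:E * (maj F1 0%R x + maj F2 (- (pi / 2))%R x + maj F2 0%R x
  + maj F1 (- (pi / 2))%R x))%E.
have Q0 x : (0 <= Q x)%E by rewrite mule_ge0 ?lee_fin// !adde_ge0.
have step1 : (\int[leb]_x (`| maximal a E f x | ^+ 2) <= \int[leb]_x Q x)%E.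
  apply: ge0_le_integral_upper => x; first by rewrite expe2 mule_ge0.
  apply: ereal_sup_sqr_le => // _ [t Et <-].
  exists (modc (propagator a t f x)) => //; split.
    by rewrite /modc; case: (propagator _ _ _ _) => p q /=; exact: sqrtr_ge0.
  apply: (@le_trans _ _ (d * (evolution w F1 t 0 x ^+ 2 +
    evolution w F2 t (- (pi / 2)) x ^+ 2 + evolution w F2 t 0 x ^+ 2 +
    evolution w F1 t (- (pi / 2)) x ^+ 2))%:E).
    by rewrite lee_fin /d -mulrA; exact: modc_propagator_le.
  rewrite EFinM lee_wpmul2l ?lee_fin// !EFinD.
  by rewrite !leeD// majE.
have step2 : (\int[leb]_x Q x <= C%:E * (Nrm F1 + Nrm F2))%E.
  have m11 := mmaj F1 0 i1; have m12 := mmaj F1 (- (pi / 2)) i1.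
  have m21 := mmaj F2 0 i2; have m22 := mmaj F2 (- (pi / 2)) i2.
  rewrite ge0_integralZl//; first last.
  - by move=> x _; rewrite !adde_ge0.
  - exact: (emeasurable_funD (emeasurable_funD (emeasurable_funD m11 m22) m21) m12).
  rewrite ge0_integralD//; first last.
  - exact: (emeasurable_funD (emeasurable_funD m11 m22) m21).
  - by move=> x _; rewrite !adde_ge0.
  rewrite ge0_integralD//; first last.
  - exact: (emeasurable_funD m11 m22).
  - by move=> x _; rewrite !adde_ge0.
  rewrite ge0_integralD//.
  have I11 := intmaj F1 0 i1; have I12 := intmaj F1 (- (pi / 2)) i1.
  have I21 := intmaj F2 0 i2; have I22 := intmaj F2 (- (pi / 2)) i2.
  rewrite [C%:E]EFinM -[leRHS]muleA; apply: lee_wpmul2l; first by rewrite lee_fin.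
  apply: (le_trans (leeD (leeD (leeD I11 I22) I21) I12)).
  have k0 : (0 <= (c * C2)%:E)%E by rewrite lee_fin mulr_ge0.
  rewrite ge0_sum4E; [|exact: mule_ge0|exact: mule_ge0].
  rewrite -ge0_muleDr// [(2 * (c * C2))%:E]EFinM -[leRHS]muleA.
  exact: lexx.
have X0 : (0 <= \int[leb]_xi ((1 + enorm xi ^+ 2) `^ s * modc (fourier f xi) ^+ 2)%:E)%E.
  by rewrite -step3 adde_ge0.
rewrite /sobolev_norm -poweR_EFin -poweRM ?lee_fin//.
apply: gt0_ler_poweR.
- by rewrite invr_ge0.
- by rewrite in_itv/= leey andbT; apply: integral_ge0 => x _; exact: mule_ge0.
- by rewrite in_itv/= leey andbT mule_ge0 ?lee_fin.
by rewrite -step3; exact: le_trans step2.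
Qed.

End maximal_bound.

(** * Nets from coverings by intervals and from dyadic grids *)

Section coverings.
Variable R : realType.
Implicit Types (E I : set R) (r : R).

Lemma interval_dist_le I r x y : is_interval I -> lebesgue_measure I = r%:E ->
  I x -> I y -> `|x - y| <= r.
Proof.
move=> iI Ir; wlog xy : x y / x <= y.
  move=> h Ix Iy; have [xy|/ltW yx] := leP x y; first exact: h.
  by rewrite distrC; exact: h.
move=> Ix Iy; rewrite distrC ger0_norm ?subr_ge0// -lee_fin -Ir.
have [->|xy'] := eqVneq x y; first by rewrite subrr measure_ge0.
have -> : (y - x)%:E = lebesgue_measure `[x, y].
  by rewrite lebesgue_measure_itv/= lte_fin lt_neqAle xy' xy -EFinB.
apply: le_measure; rewrite ?inE//=.
- exact: is_interval_measurable.
- by move=> z; rewrite /= in_itv/= => /andP[xz zy]; apply: (iI x y) => //; rewrite xz.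
Qed.

(** A finite infimum means that some cover exists, and a nonempty set of natural numbers has a least
    element. *)
Lemma covering_number_attained E r : (covering_number E r < +oo)%E ->
  exists2 N, interval_cover E r N & (N%:R%:E <= covering_number E r)%E.
Proof.
move=> cE; have [N0 N0c] : exists N, interval_cover E r N.
  apply: contrapT => h; move: cE; rewrite /covering_number.
  rewrite (_ : [set _ | _ in _] = set0) ?ereal_inf0 ?ltxx//.
  by apply/seteqP; split => [y [N Nc _]|y []]; case: h; exists N.
have ex : exists N, `[< interval_cover E r N >] by exists N0; apply/asboolP.
have := ex_minnP ex; case=> N /asboolP Nc Nmin; exists N => //.
apply: le_ereal_inf_tmp => _ [M Mc <-].
by rewrite lee_fin ler_nat; apply: Nmin; apply/asboolP.
Qed.

(** Pick one point of E in each interval that meets E and drop the other intervals; an interval of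
    length r has diameter at most r. Taking the points in E itself lets them have ancestors in
    coarser nets. *)
Lemma interval_cover_points E r N : interval_cover E r N ->
  exists e : seq R, [/\ (size e <= N)%N, forall tau, tau \in e -> E tau &
    forall t, E t -> exists2 tau, tau \in e & `|t - tau| <= r].
Proof.
move=> [I [II EI]].
have /choice[pt ptP] : forall l : 'I_N, exists o : option R,
    if o is Some x then E x /\ I l x else forall x, E x -> ~ I l x.
  move=> l; have [[x [Ex Ix]]|h] := pselect (exists x, E x /\ I l x).
    by exists (Some x).
  by exists None => x Ex Ix; apply: h; exists x.
exists (pmap pt (enum 'I_N)); split.
- by rewrite size_pmap (leq_trans (count_size _ _))// size_enum_ord.
- move=> tau; rewrite mem_pmap => /mapP[l _ ptl].
  by have := ptP l; rewrite -ptl => -[].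
- move=> t Et; have [l _ It] := EI t Et.
  have := ptP l; case ptl : (pt l) => [x|]; last by move=> h; case: (h t Et It).
  move=> [Ex Ix]; exists x; last by have [i1 i2] := II l; exact: interval_dist_le i1 i2 It Ix.
  by rewrite mem_pmap; apply/mapP; exists l; rewrite ?mem_enum.
Qed.

Lemma geometric_sum_le (q : R) K : 0 <= q < 1 -> \sum_(m < K) q ^+ m <= (1 - q)^-1.
Proof.
move=> /andP[q0 q1]; have d0 : 0 < 1 - q by rewrite subr_gt0.
rewrite -[leRHS]mul1r ler_pdivlMr// mulrC -opprB mulNr -subrX1 opprB.
by rewrite gerBl exprn_ge0.
Qed.

(** Round t + B down to a multiple of 2^-m. *)
Lemma dyadic_grid_cover (B m : nat) (t : R) : `|t| <= B%:R ->
  exists2 tau, tau \in [seq - B%:R + i%:R / 2 ^+ m | i <- iota 0 (2 * B * 2 ^ m).+1] &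
    `|t - tau| <= 2 ^- m.
Proof.
rewrite ler_norml => /andP[tB1 tB2]; have p2 : (0 : R) < 2 ^+ m by rewrite exprn_gt0.
have tB : 0 <= t + B%:R by rewrite -lerBlDr sub0r.
have z0 : 0 <= (t + B%:R) * 2 ^+ m by rewrite mulr_ge0// ltW.
have /andP[k1 k2] := truncn_itv z0.
set k := Num.truncn _ in k1 k2.
exists (- B%:R + k%:R / 2 ^+ m).
  apply/mapP; exists k => //; rewrite mem_iota add0n ltnS /=.
  rewrite -(ler_nat R) (le_trans k1)// !natrM natrX ler_wpM2r ?(ltW p2)//.
  by rewrite mulr_natl mulr2n lerD2r.
have e : t - (- B%:R + k%:R / 2 ^+ m) = ((t + B%:R) * 2 ^+ m - k%:R) / 2 ^+ m.
  by field; rewrite gt_eqF.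
rewrite e ger0_norm; last by rewrite divr_ge0 ?subr_ge0// ltW.
by rewrite ler_pdivrMr// mulVf ?gt_eqF// lerBlDl natr1 ltW.
Qed.

Lemma dyadic_grid_bounded (B m : nat) (tau : R) :
  tau \in [seq - B%:R + i%:R / 2 ^+ m | i <- iota 0 (2 * B * 2 ^ m).+1] ->
  `|tau| <= B%:R.
Proof.
have p2 : (0 : R) < 2 ^+ m by rewrite exprn_gt0.
move=> /mapP[k kB ->]; move: kB; rewrite mem_iota add0n ltnS /= => kB.
rewrite ler_norml lerDl divr_ge0 ?(ltW p2)//= addrC lerBlDr ler_pdivrMr//.
by rewrite -natrX -natrD -natrM ler_nat addnn -mul2n.
Qed.

(** The grid has at most (2B + 1) 2^m points and 2^(2 (3/4)) = 2 2^(1/2), leaving ratio 2^(-1/2).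
    The value 3/4 lies above 1/2, for this convergence, and below 1, for [gain_sum_le]. *)
Lemma dyadic_grid_sum_le (B K : nat) :
  \sum_(m < K) (size [seq (- B%:R + i%:R / 2 ^+ m : R) | i <- iota 0 (2 * B * 2 ^ m).+1])%:R
    * ((2 : R) `^ (2 * (3 / 4))) ^- m <=
  (2 * B + 1)%:R * (1 - (2 `^ 2^-1)^-1)^-1.
Proof.
have g1 : 1 < (2 : R) `^ 2^-1 by exact: two_powR_gt1.
have g0 : 0 < (2 : R) `^ 2^-1 := lt_trans ltr01 g1.
have bE : (2 : R) `^ (2 * (3 / 4)) = 2 * 2 `^ 2^-1.
  rewrite (_ : 2 * (3 / 4) = 1 + 2^-1); last by field.
  by rewrite powRD ?powRr1// pnatr_eq0 implybT.
rewrite bE; set q := (2 `^ 2^-1)^-1.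
have q01 : 0 <= q < 1 by rewrite invr_ge0 (ltW g0) invf_lt1.
apply: (@le_trans _ _ ((2 * B + 1)%:R * \sum_(m < K) q ^+ m)); last first.
  by rewrite ler_wpM2l// geometric_sum_le.
rewrite mulr_sumr; apply: ler_sum => m _.
rewrite size_map size_iota.
rewrite (_ : (2 * 2 `^ 2^-1) ^- m = 2 ^- m * q ^+ m); last by rewrite exprMn invfM /q exprVn.
rewrite mulrA; apply: ler_wpM2r; first by rewrite exprn_ge0//; have /andP[] := q01.
rewrite ler_pdivrMr ?exprn_gt0// -natrX -natrM ler_nat mulnDl mul1n -addn1.
by rewrite leq_add2l expn_gt0.
Qed.

End coverings.

(** * Conclusion: the ranges s >= a and s < a *)

Theorem corollary3 (R : realType) (n : nat) (a s : R) (E : set R)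
  (hn : (1 <= n)%N) (ha : 0 < a) (hs : 0 < s) (hE : bounded_set E)
  (hsum : (\sum_(0 <= m <oo)
      (covering_number E (2 ^- m)%R * (2 `^ (- (2 * m%:R * s / a)))%:E)
    < +oo)%E) :
  exists C : R, forall f : 'rV[R]_n -> R[i], schwartz f ->
    ((\int[lebesgue_rV]_x (`| maximal a E f x | ^+ 2)) `^ 2^-1
      <= C%:E * sobolev_norm s f)%E.
Proof.
(* For empty E the maximal function is 0 thanks to the adjoined 0; otherwise all nets are nonempty,
   as the weights require. *)
have [E0|/set0P[t0 Et0]] := eqVneq E set0.
  exists 0 => f _; rewrite mul0e.
  rewrite (eq_integral (cst 0%E)); last first.
    move=> x _; rewrite /maximal E0 image_set0 setU0 ereal_sup1.
    by rewrite abse0 expe2 mule0.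
  by rewrite integral0 poweR0r ?invr_neq0.
have [sa|sa] := ltP s a; last first.
  (* A bounded set has N(2^-m) = O(2^m), so exponents >= a reduce to 3a/4. *)
  have [M [_ EM]] := hE.
  (* Boundedness provides bounds strictly above M, hence M + 1, rounded up to an integer. *)
  pose B := (Num.truncn `|M + 1|).+1.
  have EB t : E t -> `|t| <= B%:R.
    move=> Et; apply: (le_trans (EM (M + 1) _ _ Et)); first by rewrite ltrDl.
    by rewrite (le_trans (ler_norm _))// ltW// truncnS_gt.
  apply: (@maximal_bound R n a s (3 / 4) _ E [set t | `|t| <= B%:R]
    (fun m => [seq - B%:R + i%:R / 2 ^+ m | i <- iota 0 (2 * B * 2 ^ m).+1]) ha).
  - by apply/andP; split; lra.
  - by apply: le_trans sa; rewrite ler_piMl ?(ltW ha)//; lra.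
  - exact: EB.
  - by move=> m tau; exact: dyadic_grid_bounded.
  - by move=> t m; exact: dyadic_grid_cover.
  - by move=> m; rewrite size_map size_iota.
  - by move=> K; exact: dyadic_grid_sum_le.
pose sigma := s / a.
pose cov m := covering_number E (2 ^- m).
pose b : R := 2 `^ (2 * sigma).
have b0 : 0 < b by rewrite powR_gt0.
have bE m : 2 `^ (- (2 * m%:R * s / a)) = b ^- m.
  rewrite powRN; congr (_^-1).
  rewrite (_ : 2 * m%:R * s / a = 2 * sigma * m%:R); last by rewrite /sigma; ring.
  by rewrite powRrM powR_mulrn ?powR_ge0.
have cov0 m : (0 <= cov m)%E.
  by apply: le_ereal_inf_tmp => _ [N _ <-]; rewrite lee_fin.
have term0 m : (0 <= cov m * (b ^- m)%:E)%E.
  by rewrite mule_ge0// lee_fin invr_ge0 exprn_ge0// ltW.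
have {}hsum : (\sum_(0 <= m <oo) (cov m * (b ^- m)%:E) < +oo)%E.
  by apply: le_lt_trans hsum; apply: lee_nneseries => // m _; rewrite bE.
have term_le K : (\sum_(m < K) (cov m * (b ^- m)%:E) <=
    \sum_(0 <= m <oo) (cov m * (b ^- m)%:E))%E.
  by rewrite -(big_mkord xpredT (fun m => cov m * (b ^- m)%:E)%E); exact: nneseries_lim_ge.
(* One infinite covering number, multiplied by b^-m > 0, would make the series infinite. *)
have cov_fin m : (cov m < +oo)%E.
  rewrite ltNge leye_eq; apply/negP => /eqP covy.
  have := le_lt_trans (term_le m.+1) hsum.
  rewrite big_ord_recr /= covy gt0_mulye ?lte_fin ?invr_gt0 ?exprn_gt0//.
  by rewrite addeC addye ?ltxx// gt_eqF// (lt_le_trans ltNy0)// sume_ge0.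
have /choice[e eP] m : exists e : seq R,
    [/\ ((size e)%:R%:E <= cov m)%E, forall tau, tau \in e -> E tau &
      forall t, E t -> exists2 tau, tau \in e & `|t - tau| <= 2 ^- m].
  have [N Nc Ncov] := covering_number_attained (cov_fin m).
  have [e [eN eE Ee]] := interval_cover_points Nc; exists e; split => //.
  by apply: le_trans Ncov; rewrite lee_fin ler_nat.
(* With sigma = s/a < 1 and nets of size at most N_E(2^-m), the sum of the given series bounds the
   total weight. *)
apply: (@maximal_bound R n a s sigma
  (fine (\sum_(0 <= m <oo) (cov m * (b ^- m)%:E)))%E E E e ha).
- by rewrite divr_gt0// ltr_pdivrMr// mul1r.
- by rewrite divfK// gt_eqF.
- by [].
- by move=> m tau; have [_ + _] := eP m; exact.
- by move=> t m; have [_ _ +] := eP m; exact.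
- move=> m; have [_ _ /(_ _ Et0)[tau + _]] := eP m.
  by case: (e m).
- move=> K; rewrite -lee_fin fineK; last first.
    by rewrite ge0_fin_numE//; exact: nneseries_ge0.
  apply: le_trans (term_le K); rewrite -sumEFin; apply: lee_sum => m _.
  rewrite EFinM; apply: lee_wpmul2r; last by have [] := eP m.
  by rewrite lee_fin invr_ge0 exprn_ge0// ltW.
Qed.
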